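(* Let $S=\mathfrak{A}_n$ be an alternating group with $n\ge 5$. Then $S$ satisfies Property $( * )$; that is, for every prime $p>3$ dividing $|S|$ and every almost simple group $H$ with socle $S$ and $|H:S|$ a power of $p$, there exists $\chi\in\operatorname{Irr}_{p'}(B_0(H))$ such that $d_{\chi 1_H}=0$.
   Context: For a finite group $H$ and a prime $p$, $B_0(H)$ is the principal $p$-block of $H$, and $\operatorname{Irr}_{p'}(B_0(H))$ is the set of irreducible ordinary characters in $B_0(H)$ of degree not divisible by $p$. For $\chi\in\operatorname{Irr}(H)$, $\chi^\circ$ is the restriction of $\chi$ to the $p$-regular elements, and $d_{\chi 1_H}$ is the multiplicity of the trivial irreducible $p$-Brauer character $1_H$ in the decomposition of $\chi^\circ$ into irreducible $p$-Brauer characters (a $p$-modular decomposition number). The index $|H:S|=1$ counts as a power of $p$. *)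

(* Defs.v *)
From HB Require Import structures.
From mathcomp Require Import all_boot all_order all_algebra.
From mathcomp Require Import all_fingroup all_solvable all_field all_character.

Set Implicit Arguments.
Unset Strict Implicit.
Unset Printing Implicit Defensive.

Import Order.TTheory GRing.Theory Num.Theory.
Local Open Scope group_scope.
Local Open Scope ring_scope.

(* [red] restricts to a surjective ring morphism from the ring R of algebraic *)
(* integers onto a field of characteristic p; up to isomorphism such maps are *)
(* the projections R -> R / M, for M a maximal ideal of R containing p. The   *)
(* values of [red] outside Aint are irrelevant. F is then an algebraic        *)
(* closure of 'F_p.                                                           *)
Record modular_reduction (p : nat) (F : fieldType) (red : algC -> F) : Prop :=
  ModularReduction {
    red_pchar : p \in [pchar F];
    red_one : red 1 = 1;
    red_add : {in Aint &, {morph red : x y / x + y}};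
    red_mul : {in Aint &, {morph red : x y / x * y}};
    red_onto : forall a : F, exists2 x, x \in Aint & red x = a
  }.

Section Groups.

Variable gT : finGroupType.
Implicit Types G H N : {group gT}.

(* [minnormal N H] alone only says that N is normalised by H. *)
Definition gsocle H : {set gT} :=
  <<\bigcup_(N : {group gT} | (N \subset H) && minnormal N H) N>>%g.

(* Inn S <= A <= Aut S and H isomorphic to A, with S nonabelian simple;      *)
(* conj_aut S @* S is the group of inner automorphisms of S.                 *)
Definition almost_simple H : Prop :=
  exists (sT : finGroupType) (S : {group sT}) (A : {group {perm sT}}),
    [/\ simple S, ~~ abelian S, (conj_aut S @* S)%g \subset A,
        A \subset Aut S & H \isog A].

Definition preg (p : nat) G : {set gT} := [set x in G | p^'.-elt x].

End Groups.

Section Brauer.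

Variables (p : nat) (F : fieldType) (red : algC -> F).
Variables (gT : finGroupType) (G : {group gT}).

(* Functions on the p-regular elements of G are extended by 0 to class        *)
(* functions on G; this is the restriction chi |-> chi^o.                     *)
Definition cfpreg (chi : 'CF(G)) : 'CF(G) := chi * '1_(preg p G).

(* phi is the Brauer character of rG: phi(x) is the sum, with multiplicity,   *)
(* of the lifts along [red] of the eigenvalues of rG x to complex roots of    *)
(* unity of order prime to p.                                                 *)
Definition affords_brauer n (rG : mx_representation F G n) (phi : 'CF(G)) :=
  phi \in 'CF(G, preg p G) /\
  {in preg p G, forall x, exists xi : seq algC,
    [/\ {in xi, forall z, exists2 k, ~~ (p %| k)%N & z ^+ k = 1},
        char_poly (rG x) = \prod_(z <- xi) ('X - (red z)%:P)
      & phi x = \sum_(z <- xi) z]}.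

Definition irr_brauer (phi : 'CF(G)) : Prop :=
  exists n (rG : mx_representation F G n),
    mx_irreducible rG /\ affords_brauer rG phi.

(* d = d_{chi phi}: the list s spells out the (unique) decomposition of chi^o *)
(* as a sum of irreducible Brauer characters, with repetitions.               *)
Definition decomposition_number (chi phi : 'CF(G)) (d : nat) : Prop :=
  exists s : seq 'CF(G),
    [/\ {in s, forall psi, irr_brauer psi},
        cfpreg chi = \sum_(psi <- s) psi
      & count_mem phi s = d].

Definition trivial_brauer : 'CF(G) := cfpreg 1.

(* The ordinary characters in B_0(G): those whose central character agrees    *)
(* with that of 'chi_0 = 1_G modulo the maximal ideal ker red.                *)
Definition principal_block : {set Iirr G} :=
  [set i | [forall k, red 'omega_i['K_k] == red 'omega_(0 : Iirr G)['K_k]]].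

Definition p'_principal_block : {set Iirr G} :=
  [set i in principal_block | ~~ (p %| 'chi_i 1%g)%C].

Lemma preg_normal : preg p G <| G.
Proof.
apply/andP; split; first by apply/subsetP=> x /setIdP[].
apply/subsetP=> x Gx; rewrite inE; apply/subsetP=> _ /imsetP[y + ->].
by rewrite !inE => /andP[Gy py]; rewrite groupJ //= p_eltJ.
Qed.

Lemma cfpregE chi x : cfpreg chi x = chi x *+ (x \in preg p G).
Proof. by rewrite cfunE cfuniE ?preg_normal // mulr_natr. Qed.

Lemma irr_brauer_trivial :
  modular_reduction p red -> irr_brauer trivial_brauer.
Proof.
case=> pF red1 _ _ _.
have rP : mx_repr G (fun _ : gT => 1%:M : 'M[F]_1).
  by split=> // x y _ _; rewrite mul1mx.
exists 1, (MxRepresentation rP); split.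
  by apply/mx_abs_irrW; exact: linear_mx_abs_irr.
split; first by apply/cfun_onP=> x /negPf xG; rewrite cfpregE xG.
move=> x xG; exists [:: 1]; split.
- move=> z; rewrite inE => /eqP->; exists 1%N; rewrite ?expr1n //.
  by rewrite dvdn1 neq_ltn prime_gt1 ?orbT // (pcharf_prime pF).
- rewrite big_seq1 red1 /char_poly /char_poly_mx det_mx11 !mxE eqxx.
  by rewrite !mulr1n.
by rewrite big_seq1 cfpregE xG cfun1E; case/setIdP: xG => ->.
Qed.

End Brauer.

Definition property_star (sT : finGroupType) (S : {group sT}) : Prop :=
  forall p : nat, prime p -> (3 < p)%N -> (p %| #|S|)%N ->
  forall (gT : finGroupType) (H : {group gT}),
    almost_simple H -> gsocle H \isog S -> p.-nat #|H : gsocle H| ->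
  forall (F : fieldType) (red : algC -> F), modular_reduction p red ->
  exists2 i : Iirr H, i \in p'_principal_block p red H
    & decomposition_number p red 'chi_i (trivial_brauer p H) 0.

(* Main.v *)
(* The automorphisms of A_n relevant here preserve the 3-cycles: 3-cycles are *)
(* characterized intrinsically when n <> 6, and for n = 6, p = 5 the 5-group  *)
(* H / N, N the socle, cannot act nontrivially on a Sylow 3-subgroup, of      *)
(* order 9. Images of (z0 z1 i) under such an automorphism have the shape     *)
(* (a b f(i)), so it is induced by S_n; as |H : N| is odd, H = N.             *)
(*   For H = A_n, n = Q + s with Q = c * p^j the leading part of the base p   *)
(* expansion of n, let M_i be induced from S_i x S_(Q-i) x S_s and the        *)
(* character sgn (x) 1 (x) 1. The full alternating sum of the M_i, i <= Q,    *)
(* vanishes; its truncation theta at i <= k has degree, up to sign,           *)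
(* C(Q-1, k) C(n, Q), prime to p. For a Young subgroup K with blocks of size  *)
(* 4 (a p'-group as p > 3) and suitable k, the M_i with i > k have no nonzero *)
(* K-fixed vectors and those with i <= k no K-sign vectors, so no constituent *)
(* of theta has fixed vectors under L = K :&: A_n. Moreover theta(x) and      *)
(* theta(1) are congruent modulo p if the class of x has p'-size, because the *)
(* p'-part of x then commutes with c disjoint p^j-cycles. Hence theta has a   *)
(* p'-degree constituent chi in the principal block. Finally L has no fixed   *)
(* vectors in any reduction of chi modulo p, so neither does G, in any        *)
(* composition factor: the trivial Brauer character does not occur.           *)

From HB Require Import structures.
Require Import Defs.
From mathcomp Require Import all_boot all_order all_algebra.
From mathcomp Require Import all_fingroup all_solvable all_field all_character.
From mathcomp Require Import boolp zify.

Set Implicit Arguments.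
Unset Strict Implicit.
Unset Printing Implicit Defensive.

Import Order.TTheory GRing.Theory Num.Theory.
Local Open Scope group_scope.

(** * Extensions of alternating groups by odd p-groups *)

(** The group H is shown to be its socle ([Alt_odd_extension]). Conjugation by h in H maps 3-cycles
    of the socle to 3-cycles, hence the family (z0 z1 i), whose pairwise products are involutions,
    to a family (a b f(i)); so h acts like some permutation s. Then h^2 acts like the even
    permutation s^2 and lies in the socle, which has trivial centralizer; h itself does because the
    index is odd.

    For A_n, no knowledge of its blocks or decomposition matrices enters: chi is found as a
    constituent of a virtual character theta ([avoiding_vchar]). Up to sign, theta is the
    restriction to A_n of the character induced from S_Q x S_s of a hook character (Q-k, 1^k) times
    the trivial one; as a truncated alternating sum of signed permutation characters ([hook_char])
    it is accessible to counting. Its degree is prime to p ([hook_char1], [p'binomial_pred],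
    [p'binomial_add]), and modulo ker red it is constant on the classes of p'-size
    ([hook_char_principal]); these two facts give a constituent of p'-degree in the principal block
    ([p'_principal_block_constituent]).

    No constituent of theta has vectors fixed by a certain p'-subgroup L
    ([hook_Alt_constituent_sum]): since the full alternating sum vanishes ([alternating_sum]), a
    constituent of the truncated sum for S_n occurs in terms on both sides of the truncation. As
    #|L| is nonzero in F, the absence of L-fixed vectors survives reduction modulo p and passage to
    composition factors, whereas the trivial module is fixed by L ([decomposition_number_trivial0]).
    The reduction uses an invariant lattice over the localization of the algebraic integers at ker
    red, a valuation ring ([local_total], [integral_form]). *)

Section ThreeCycles.

Variable T : finType.
Implicit Types (a b d e u v x y : T) (s t w z : {perm T}).
Local Notation A := 'Alt_T.

(** Products act from left to right, so this is the cycle (a b d). *)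
Definition c3 a b d : {perm T} := tperm a b * tperm a d.

Definition distinct3 a b d := [&& a != b, b != d & d != a].

Lemma c3_1 a b d : distinct3 a b d -> c3 a b d a = b.
Proof.
by case/and3P=> ab bd da; rewrite permM tpermL tpermD // eq_sym.
Qed.

Lemma c3_2 a b d : distinct3 a b d -> c3 a b d b = d.
Proof. by move=> _; rewrite permM tpermR tpermL. Qed.

Lemma c3_3 a b d : distinct3 a b d -> c3 a b d d = a.
Proof.
by case/and3P=> ab bd da; rewrite permM [tperm a b d]tpermD ?tpermR // eq_sym.
Qed.

Lemma c3_out a b d x : x != a -> x != b -> x != d -> c3 a b d x = x.
Proof. by move=> xa xb xd; rewrite permM !tpermD // eq_sym. Qed.

Lemma distinct3_rot a b d : distinct3 a b d -> distinct3 b d a.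
Proof. by case/and3P=> ab bd da; apply/and3P. Qed.

Lemma eq_c3 a b d s : distinct3 a b d -> s a = b -> s b = d -> s d = a ->
  (forall x, x != a -> x != b -> x != d -> s x = x) -> s = c3 a b d.
Proof.
move=> D sa sb sd s_out; apply/permP=> x.
have [-> | xa] := eqVneq x a; first by rewrite c3_1.
have [-> | xb] := eqVneq x b; first by rewrite c3_2.
have [-> | xd] := eqVneq x d; first by rewrite c3_3.
by rewrite c3_out // s_out.
Qed.

Lemma c3_rot a b d : distinct3 a b d -> c3 a b d = c3 b d a.
Proof.
move=> D; apply: eq_c3 (distinct3_rot D) _ _ _ _; rewrite ?c3_1 ?c3_2 ?c3_3 //.
by move=> x xb xd xa; rewrite c3_out.
Qed.

Lemma c3_moved a b d x : distinct3 a b d -> c3 a b d x != x -> [\/ x = a, x = b | x = d].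
Proof.
move=> D; have [-> | xa] := eqVneq x a; first by constructor 1.
have [-> | xb] := eqVneq x b; first by constructor 2.
have [-> | xd] := eqVneq x d; first by constructor 3.
by rewrite c3_out ?eqxx.
Qed.

Lemma c3J a b d s : c3 a b d ^ s = c3 (s a) (s b) (s d).
Proof. by rewrite conjMg !tpermJ. Qed.

Lemma c3_Alt a b d : distinct3 a b d -> c3 a b d \in A.
Proof.
case/and3P=> ab bd da; rewrite Alt_even odd_permM !odd_tperm ab [a == d]eq_sym da //.
Qed.

Definition is_c3 s := exists a b d, distinct3 a b d /\ s = c3 a b d.

Lemma is_c3_Alt s : is_c3 s -> s \in A.
Proof. by case=> a [b [d [D ->]]]; apply: c3_Alt. Qed.

Lemma is_c3J s t : is_c3 s -> is_c3 (s ^ t).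
Proof.
case=> a [b [d [/and3P[ab bd da] ->]]]; rewrite c3J; exists (t a), (t b), (t d).
by rewrite /distinct3 !(inj_eq perm_inj) ab bd da.
Qed.

Lemma is_c3_at s x : is_c3 s -> s x != x ->
  distinct3 x (s x) (s (s x)) /\ s = c3 x (s x) (s (s x)).
Proof.
case=> a [b [d [D ->]]] /c3_moved[] // ->.
- by rewrite (c3_1 D) (c3_2 D).
- by rewrite (c3_2 D) (c3_3 D); split; [apply: distinct3_rot | apply: c3_rot].
rewrite (c3_3 D) (c3_1 D); have D' := distinct3_rot (distinct3_rot D).
by split; rewrite // (c3_rot D').
Qed.

Lemma expg3E s x : (s ^+ 3) x = s (s (s x)).
Proof. by rewrite !expgS expg0 mulg1 !permM. Qed.

Lemma c3_expg3 a b d : distinct3 a b d -> c3 a b d ^+ 3 = 1.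
Proof.
move=> D; apply/permP=> x; rewrite perm1 expg3E.
have [/eqP fx | /(c3_moved D)[] ->] := boolP (c3 a b d x == x).
- by rewrite !fx.
- by rewrite (c3_1 D) (c3_2 D) (c3_3 D).
- by rewrite (c3_2 D) (c3_3 D) (c3_1 D).
by rewrite (c3_3 D) (c3_1 D) (c3_2 D).
Qed.

Lemma c3_neq1 a b d : distinct3 a b d -> c3 a b d != 1.
Proof.
move=> D; apply/eqP=> /permP/(_ a); rewrite perm1 (c3_1 D) => ba.
by case/and3P: D; rewrite ba eqxx.
Qed.

(* An Aut(A)-invariant property, holding exactly for the 3-cycles among the   *)
(* elements of order 3 unless #|T| = 6; an outer automorphism of S_6 maps     *)
(* 3-cycles to products of two disjoint 3-cycles.                             *)
Definition c3_like t := forall s, s \in A -> commute s t -> s ^+ 3 = 1 ->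
  (forall z, z \in A -> commute z t -> commute s (s ^ z)) -> [\/ s = 1, s = t | s = t^-1].

Lemma commuteE s t : commute s t -> forall x, t (s x) = s (t x).
Proof. by move=> cst x; rewrite -!permM cst. Qed.

Lemma expg3_orbit s x : s ^+ 3 = 1 -> s (s (s x)) = x.
Proof. by move/permP/(_ x); rewrite perm1 expg3E. Qed.

Lemma expg3_distinct s x : s ^+ 3 = 1 -> s x != x -> distinct3 x (s x) (s (s x)).
Proof.
move=> s3 sx; apply/and3P; split; first by rewrite eq_sym.
  by rewrite eq_sym (inj_eq perm_inj).
by apply: contra sx => /eqP ssx; rewrite -{2}(expg3_orbit x s3) ssx.
Qed.

Lemma commute_conj z t : t ^ z = t -> commute z t.
Proof. by move=> tz; rewrite /commute [RHS]conjgC tz. Qed.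

(** An s commuting with t = (a b d) agrees with a power of t on {a, b, d}; dividing by it, one may
    assume that s fixes a, b and d. If s still had a cycle (x e f), a seventh point g would give z =
    (e f g) commuting with t, while s and s ^ z do not commute. *)
Lemma is_c3_like t : #|T| != 6 -> is_c3 t -> c3_like t.
Proof.
move=> n6 [a [b [d [D Dt]]]] s As cst s3 sJ.
have ta : t a = b by rewrite Dt c3_1.
have tb : t b = d by rewrite Dt c3_2.
have td : t d = a by rewrite Dt c3_3.
have t3 : t ^+ 3 = 1 by rewrite Dt c3_expg3.
have At : t \in A by rewrite Dt c3_Alt.
(* s agrees with some t^j on the support of t; this is applied to s t^-j. *)
have fixed s' : s' \in A -> commute s' t -> s' ^+ 3 = 1 -> s' a = a ->
    (forall z, z \in A -> commute z t -> commute s' (s' ^ z)) -> s' = 1.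
  move=> As' cs't s'3 s'a s'J; apply/eqP; apply: contraT => ns'1.
  have s'b : s' b = b by rewrite -ta -(commuteE cs't) s'a.
  have s'd : s' d = d by rewrite -tb -(commuteE cs't) s'b.
  have [x nx] : exists x, s' x != x.
    apply/existsP; apply: contraNT ns'1 => /existsPn fix_s.
    by apply/eqP/permP=> x; rewrite perm1; apply/eqP; have := fix_s x; rewrite negbK.
  have Dx := expg3_distinct s'3 nx; set e := s' x in Dx; set f := s' e in Dx.
  have s'f : s' f = x by apply: expg3_orbit.
  have outside u : s' u != u -> [/\ u != a, u != b & u != d].
    by move=> nu; split; apply: contraNneq nu => ->; rewrite ?s'a ?s'b ?s'd.
  have [xe ef fx] := and3P Dx.
  have [xa xb xd] := outside x nx.
  have [ea eb ed] : [/\ e != a, e != b & e != d] by apply: outside; rewrite eq_sym.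
  have [fa fb fd] : [/\ f != a, f != b & f != d] by apply: outside; rewrite s'f eq_sym.
  have [ab bd da] := and3P D.
  have [g] : exists g, g \notin [:: a; b; d; x; e; f].
    apply/existsP; apply: contraR n6 => /existsPn all6.
    have U6 : uniq [:: a; b; d; x; e; f].
      rewrite /= !inE !negb_or ab bd (eq_sym a d) da !(eq_sym a) !(eq_sym b) !(eq_sym d).
      by rewrite xa xb xd ea eb ed fa fb fd xe ef (eq_sym x f) fx.
    have -> : #|T| = #|[:: a; b; d; x; e; f]|.
      by apply: eq_card => u; have := all6 u; rewrite negbK => ->.
    by rewrite (card_uniqP U6).
  rewrite !inE !negb_or => /and5P[ga gb gd gx /andP[ge gf]].
  have Dz : distinct3 e f g by apply/and3P; split=> //; rewrite eq_sym.
  (* Here s' ^ z maps x to f and f to g; commuting with s' would give s' g = f = s' e. *)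
  pose z := c3 e f g.
  have z_abd : [/\ z a = a, z b = b & z d = d].
    by split; apply: c3_out; rewrite eq_sym.
  have czt : commute z t.
    by apply: commute_conj; case: z_abd => za zb zd; rewrite Dt c3J za zb zd.
  have := commuteE (s'J z (c3_Alt Dz) czt) f.
  have zx : z x = x by apply: c3_out => //; rewrite eq_sym.
  have -> : (s' ^ z) (s' f) = f by rewrite s'f -{1}zx permJ -/e /z (c3_1 Dz).
  have -> : (s' ^ z) f = g by rewrite -{1}(c3_1 Dz) permJ -/f /z (c3_2 Dz).
  by move/perm_inj/eqP; rewrite eq_sym (negPf ge).
(* For u a power of t, every condition on s carries over to s * u, because u commutes with the whole
   centralizer of t. *)
have twist (u : {perm T}) : u \in A -> u ^+ 3 = 1 -> (forall w, commute w t -> commute w u) -> (s * u) a = a -> s * u = 1.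
  move=> Au u3 cu sua; have csu := cu s cst.
  have ctu := cu t (commute_refl t).
  apply: fixed => //.
  - exact: groupM.
  - by apply/commute_sym/commuteM; apply: commute_sym.
  - by rewrite expgMn // s3 u3 mulg1.
  move=> z Az czt; have uz : u ^ z = u by apply/conjg_fixP/commgP/commute_sym/cu.
  have csz : commute (s ^ z) u.
    apply: cu; have -> : t = t ^ z by apply/esym/conjg_fixP/commgP/commute_sym.
    by rewrite /commute -!conjMg cst.
  rewrite conjMg uz; apply: commuteM; last by apply/commute_sym/commuteM => //; exact: commute_sym.
  by apply/commute_sym/commuteM; apply: commute_sym => //; apply: sJ.
have ns : t (s a) != s a by rewrite (commuteE cst) ta (inj_eq perm_inj); case/and3P: D; rewrite eq_sym.
have [] := c3_moved D (_ : c3 a b d (s a) != s a) => [|sa|sa|sa]; first by rewrite -Dt.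
- by constructor 1; rewrite -[s]mulg1; apply: twist; rewrite ?group1 ?expg1n ?mulg1 // => w _; apply: commute1.
- constructor 2; apply/eqP; rewrite eq_mulgV1; apply/eqP/twist.
  + by rewrite groupV.
  + by rewrite expgVn t3 invg1.
  + by move=> w; apply: commuteV.
  by rewrite permM sa -ta permK.
constructor 3; apply/eqP; rewrite eq_mulgV1 invgK; apply/eqP/twist => //.
by rewrite permM sa.
Qed.

Lemma c3V a b d : distinct3 a b d -> distinct3 a d b /\ (c3 a b d)^-1 = c3 a d b.
Proof.
move=> D; have [ab bd da] := and3P D.
have D' : distinct3 a d b by rewrite /distinct3 (eq_sym a) da (eq_sym d) bd eq_sym ab.
split=> //; apply: eq_c3 => //.
- by rewrite -{2}(c3_3 D) permK.
- by rewrite -{2}(c3_2 D) permK.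
- by rewrite -{2}(c3_1 D) permK.
by move=> x xa xd xb; rewrite -{1}(c3_out xa xb xd) permK.
Qed.

Lemma is_c3V t : is_c3 t -> is_c3 t^-1.
Proof. by case=> a [b [d [/c3V[D' Dt] ->]]]; rewrite Dt; exists a, d, b. Qed.

(** Take for s a single cycle of w. Its conjugates under the centralizer of w are again cycles of w,
    equal to it or disjoint from it, so they commute with it; hence s is w or its inverse. *)
Lemma c3_like_is_c3 w : w \in A -> w ^+ 3 = 1 -> w != 1 -> c3_like w -> is_c3 w.
Proof.
move=> Aw w3 nw1 like_w.
have [x nx] : exists x, w x != x.
  apply/existsP; apply: contraNT nw1 => /existsPn fix_w.
  by apply/eqP/permP=> x; rewrite perm1; apply/eqP; have := fix_w x; rewrite negbK.
pose y u := c3 u (w u) (w (w u)).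
have w3E := expg3_orbit _ w3.
have Dy u : w u != u -> distinct3 u (w u) (w (w u)) by apply: expg3_distinct.
have y_rot u : w u != u -> y (w u) = y u by move=> nu; rewrite /y w3E [RHS]c3_rot // Dy.
have nw u : w u != u -> w (w u) != w u by rewrite (inj_eq perm_inj).
have yJ z u : commute z w -> y u ^ z = y (z u) by move=> czw; rewrite c3J /y !(commuteE czw).
have cyw : commute (y x) w.
  by apply/commute_sym/commute_conj; rewrite yJ // y_rot.
have yJy z : z \in A -> commute z w -> commute (y x) (y x ^ z).
  move=> Az czw; rewrite yJ //; set u := z x.
  have nu : w u != u by rewrite (commuteE czw) (inj_eq perm_inj).
  have [-> | ux] := eqVneq u x; first exact: commute_refl.
  have [-> | uwx] := eqVneq u (w x); first by rewrite y_rot //; apply: commute_refl.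
  have [-> | uwwx] := eqVneq u (w (w x)); first by rewrite y_rot ?y_rot ?nw //; apply: commute_refl.
  apply: commute_conj; rewrite c3J.
  have fix_y v : v != x -> v != w x -> v != w (w x) -> y x v = v by apply: c3_out.
  rewrite !fix_y //.
  + by apply: contra uwx => /eqP wwu; rewrite -wwu w3E.
  + by rewrite (inj_eq perm_inj) //; apply: contra uwwx => /eqP<-; rewrite w3E.
  + by rewrite !(inj_eq perm_inj).
  + by apply: contra uwwx => /eqP<-; rewrite w3E.
  + by rewrite (inj_eq perm_inj).
  by rewrite (inj_eq perm_inj).
case: (like_w _ (c3_Alt (Dy x nx)) cyw (c3_expg3 (Dy x nx)) yJy) => [y1 | yw | yV].
- by have := c3_neq1 (Dy x nx); rewrite y1 eqxx.
- by exists x, (w x), (w (w x)); split; rewrite ?Dy ?yw.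
rewrite -[w]invgK -yV; apply: is_c3V.
by exists x, (w x), (w (w x)); split; rewrite ?Dy.
Qed.

Lemma is_c3_expg3 s : is_c3 s -> s ^+ 3 = 1.
Proof. by case=> a [b [d [D ->]]]; apply: c3_expg3. Qed.

Lemma is_c3_neq1 s : is_c3 s -> s != 1.
Proof. by case=> a [b [d [D ->]]]; apply: c3_neq1. Qed.

Lemma is_c3_moved s x u : is_c3 s -> s x != x -> s u != u ->
  [\/ u = x, u = s x | u = s (s x)].
Proof. by move=> s3 sx; have [D Ds] := is_c3_at s3 sx; rewrite {1}Ds => /(c3_moved D). Qed.

Lemma c3_eq s t x : is_c3 s -> is_c3 t -> s x != x -> t x = s x -> t (t x) = s (s x) -> s = t.
Proof.
move=> s3 t3 sx tx ttx; have tx' : t x != x by rewrite tx.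
have [_ ->] := is_c3_at s3 sx; have [_ ->] := is_c3_at t3 tx'.
by rewrite ttx tx.
Qed.

(** If t moved only points moved by s, then t would be s or its inverse, both excluded. So t moves
    some d fixed by s, and evaluating (s t)^2 = 1 at s^-1 (t (t d)) shows that s and t share the
    directed edge from t d to t (t d). *)
Lemma share_edge s t : is_c3 s -> is_c3 t -> (s * t) ^+ 2 = 1 -> s * t != 1 ->
  exists x, [/\ t x = s x, s x != x & s (t (t x)) = t (t x)].
Proof.
move=> s3 t3 st2 nst1; have tE := expg3_orbit _ (is_c3_expg3 t3).
have [d /andP[td sd]] : exists d, (t d != d) && (s d == d).
  apply/existsP; apply: contraNT nst1 => /existsPn sub.
  have moved u : t u != u -> s u != u by move=> tu; have := sub u; rewrite tu.
  have [x [x1 [x2 [Dx Dt]]]] := t3; have tx : t x != x.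
    by rewrite Dt (c3_1 Dx) eq_sym; case/and3P: Dx.
  have ttx : t (t x) != t x by rewrite (inj_eq perm_inj).
  have tttx : t (t (t x)) != t (t x) by rewrite !(inj_eq perm_inj).
  have sx := moved _ tx; have [Dsx Ds] := is_c3_at s3 sx.
  have [Dtx _] := is_c3_at t3 tx; have [xt ttt ttx_x] := and3P Dtx.
  case: (is_c3_moved s3 sx (moved _ ttx)) => [txx | tsx | tssx].
  - by rewrite txx eqxx in tx.
  - case: (is_c3_moved s3 sx (moved _ tttx)) => [txx | ttsx | ttssx].
    + by rewrite txx eqxx in ttx_x.
    + by rewrite ttsx tsx eqxx in ttt.
    case/eqP: (is_c3_neq1 t3); rewrite -st2 (c3_eq s3 t3 sx tsx ttssx).
    by rewrite -[t * t]expg2 -expgM (expgD t 3 1) is_c3_expg3 // mul1g expg1.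
  case: (is_c3_moved s3 sx (moved _ tttx)) => [txx | ttsx | ttssx].
  + by rewrite txx eqxx in ttx_x.
  + have [D' sV] := c3V Dsx; rewrite -Ds in sV.
    have [_ ->] := is_c3_at t3 tx; rewrite ttsx tssx -sV.
    by rewrite mulgV.
  by rewrite ttssx tssx eqxx in ttt.
exists (t d); have ttd : t (t d) != t d by rewrite (inj_eq perm_inj).
have E u : t (s (t (s u))) = u by have /permP/(_ u) := st2; rewrite expg2 !permM perm1.
have st : s (t d) = t (t d).
  by have := E (s^-1 (t (t d))); rewrite permKV tE (eqP sd) => /(congr1 s); rewrite permKV.
by split; rewrite ?st ?tE ?(eqP sd).
Qed.

(** An edge of (a b d) and an edge of (a b e), both different from a -> b, have a common source, or
    a common target, or cover four points; a 3-cycle cannot contain both. So one of the two shared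
    edges is a -> b. *)
Lemma share_edge_third a b d e s : distinct3 a b d -> distinct3 a b e -> d != e -> is_c3 s ->
    (exists x, [/\ s x = c3 a b d x, c3 a b d x != x & c3 a b d (s (s x)) = s (s x)]) ->
    (exists x, [/\ s x = c3 a b e x, c3 a b e x != x & c3 a b e (s (s x)) = s (s x)]) ->
  s a = b.
Proof.
move=> D1 D2 de s3; set r1 := c3 a b d; set r2 := c3 a b e.
case=> x [sx r1x r1ssx] [x' [sx' r2x' r2ssx']].
have mx : s x != x by rewrite sx.
have mx' : s x' != x' by rewrite sx'.
have sE := expg3_orbit _ (is_c3_expg3 s3).
have fix2 u : r1 u != u -> r2 u = u -> u = d.
  move=> /(c3_moved D1)[] -> //; rewrite /r2 ?(c3_1 D2) ?(c3_2 D2).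
    by move=> ba; case/and3P: D1; rewrite ba eqxx.
  by move=> eb; case/and3P: D2; rewrite eb eqxx.
have [ab bd da] := and3P D1.
have r2d : r2 d = d by rewrite /r2 c3_out // eq_sym.
case: (is_c3_moved s3 mx mx') => Dx'; subst x'.
- move: sx'; rewrite sx; case: (c3_moved D1 r1x) => Dx; subst x.
  + by rewrite sx /r1 (c3_1 D1).
  + by rewrite /r1 /r2 (c3_2 D1) (c3_2 D2) => ed; rewrite ed eqxx in de.
  by rewrite r2d /r1 (c3_3 D1) => ad; rewrite ad eqxx in da.
- rewrite sE in r2ssx'; have xd := fix2 _ r1x r2ssx'; subst x.
  by move: sx'; rewrite sx /r1 (c3_3 D1) /r2 (c3_1 D2).
rewrite !sE in r2ssx' sx'.
have sxd : s x = d by apply: fix2 r2ssx'; rewrite sx (inj_eq perm_inj).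
have xb : x = b by apply: (perm_inj (s := r1)); rewrite -sx sxd /r1 (c3_2 D1).
have ssa : s (s x) = a by apply: (perm_inj (s := r2)); rewrite -sx' xb /r2 (c3_1 D2).
by move: r1ssx; rewrite ssa /r1 (c3_1 D1) => ba; rewrite ba eqxx in ab.
Qed.

(** * The 3-cycles (z0 z1 i): relations, rigidity and generation *)

Section StarGenerators.

Variables (z0 z1 : T).
Hypothesis z01 : z0 != z1.

Definition star i := c3 z0 z1 i.
Definition off i := (i != z0) && (i != z1).

Lemma star_distinct i : off i -> distinct3 z0 z1 i.
Proof. by case/andP=> i0 i1; apply/and3P; rewrite [z1 == i]eq_sym. Qed.

Lemma star_is_c3 i : off i -> is_c3 (star i).
Proof. by move/star_distinct=> D; exists z0, z1, i. Qed.

(** The product is the double transposition (z0 j)(z1 i). *)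
Lemma star_mul i j : off i -> off j -> i != j ->
  (star i * star j) ^+ 2 = 1 /\ star i * star j != 1.
Proof.
move=> oi oj ij; have [Di Dj] := (star_distinct oi, star_distinct oj).
have [/andP[i0 i1] /andP[j0 j1]] := (oi, oj).
have ji : star j i = i by apply: c3_out.
have ij' : star i j = j by apply: c3_out; rewrite // eq_sym.
have e0 : star j (star i z0) = j by rewrite /star (c3_1 Di) (c3_2 Dj).
have e1 : star j (star i z1) = i by rewrite {2}/star (c3_2 Di).
have ei : star j (star i i) = z1 by rewrite /star (c3_3 Di) (c3_1 Dj).
have ej : star j (star i j) = z0 by rewrite ij' /star (c3_3 Dj).
have mulE (s t : {perm T}) x : (s * t) x = t (s x) by exact: permM.
have sqE (s t : {perm T}) x : ((s * t) ^+ 2) x = t (s (t (s x))).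
  by rewrite expg2 !mulE.
split.
  apply/permP=> x; rewrite perm1 sqE.
  have [-> | x0] := eqVneq x z0; first by rewrite e0 ej.
  have [-> | x1] := eqVneq x z1; first by rewrite e1 ei.
  have [-> | xi] := eqVneq x i; first by rewrite ei e1.
  have [-> | xj] := eqVneq x j; first by rewrite ej e0.
  have six : star i x = x by apply: c3_out.
  have sjx : star j x = x by apply: c3_out.
  by rewrite six sjx six sjx.
by apply/eqP=> /permP/(_ z0); rewrite mulE e0 perm1 => /eqP; rewrite (negPf j0).
Qed.

Lemma star_inj i j : off i -> off j -> star i = star j -> i = j.
Proof.
move=> oi oj /permP/(_ z1); rewrite /star.
by rewrite (c3_2 (star_distinct oi)) (c3_2 (star_distinct oj)).
Qed.

(** Two members of the family share an edge a -> b, and by [share_edge_third] every other member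
    contains it too. The conjugating permutation sends z0 to a, z1 to b and i to the third point of
    [rho i]. *)
Lemma star_family (rho : T -> {perm T}) : 4 < #|T| ->
    (forall i, off i -> is_c3 (rho i)) ->
    (forall i j, off i -> off j -> i != j -> (rho i * rho j) ^+ 2 = 1 /\ rho i * rho j != 1) ->
    (forall i j, off i -> off j -> rho i = rho j -> i = j) ->
  exists s : {perm T}, forall i, off i -> rho i = star i ^ s.
Proof.
move=> n5 rho3 rho_mul rho_inj.
have [i [j [oi oj ij]]] : exists i j, [/\ off i, off j & i != j].
  have cardC : 2 < #|[set~ z0] :\ z1|.
    have := cardsD1 z1 [set~ z0]; rewrite !inE eq_sym z01 cardsC1.
    by move: n5; case: #|T| => [|[|[|[|[|m]]]]] //= _; rewrite add1n => -[<-].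
  have /card_gt1P[i [j [Ci Cj ij]]] := ltnW cardC.
  by exists i, j; move: Ci Cj; rewrite !inE /off andbC => -> /[1!andbC] ->.
have edge k l : off k -> off l -> k != l -> exists x,
    [/\ rho l x = rho k x, rho k x != x & rho k (rho l (rho l x)) = rho l (rho l x)].
  by move=> ok ol kl; have [m2 m1] := rho_mul k l ok ol kl; apply: share_edge; auto.
have [a [eq_b nb fix_d]] := edge i j oi oj ij.
pose b := rho i a; pose c := rho i b; pose d := rho j b.
have [Di rhoi] := is_c3_at (rho3 i oi) nb; rewrite -/b -/c in Di rhoi.
have nb' : rho j a != a by rewrite eq_b.
have [Dj rhoj] := is_c3_at (rho3 j oj) nb'; rewrite eq_b -/b -/d in Dj rhoj.
have ncd : c != d.
  rewrite eq_b -/b -/d in fix_d; apply/eqP=> cd; rewrite -cd rhoi (c3_3 Di) in fix_d.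
  by have /and3P[_ _] := Di; rewrite {1}fix_d eqxx.
have ab k : off k -> rho k a = b.
  move=> ok; have [-> // | ki] := eqVneq k i.
  have [-> | kj] := eqVneq k j; first by rewrite eq_b.
  apply: (share_edge_third Di Dj ncd (rho3 k ok)).
    by rewrite -rhoi; apply: edge; rewrite // eq_sym.
  by rewrite -rhoj; apply: edge; rewrite // eq_sym.
have na_b : b != a by rewrite eq_sym; case/and3P: Di.
have rhoE k : off k -> distinct3 a b (rho k b) /\ rho k = c3 a b (rho k b).
  by move=> ok; have := is_c3_at (x := a) (rho3 k ok); rewrite ab //; apply.
pose f x := if x == z0 then a else if x == z1 then b else rho x b.
have f_off k : off k -> f k = rho k b by case/andP=> k0 k1; rewrite /f (negPf k0) (negPf k1).
have f0 : f z0 = a by rewrite /f eqxx.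
have f1 : f z1 = b by rewrite /f eq_sym (negPf z01) eqxx.
have split_x x : [\/ x = z0, x = z1 | off x].
  have [-> | x0] := eqVneq x z0; first by constructor 1.
  have [-> | x1] := eqVneq x z1; first by constructor 2.
  by constructor 3; apply/andP.
have nf k : off k -> (f k != a) && (f k != b).
  by move=> ok; have [/and3P[_ bk ka] _] := rhoE k ok; rewrite f_off // ka eq_sym.
have f_inj : injective f.
  move=> x y; case: (split_x x) => [->|->|ox]; case: (split_x y) => [->|->|oy] //.
  - by rewrite f0 f1 => /eqP; rewrite eq_sym (negPf na_b).
  - by rewrite f0 => /eqP; rewrite eq_sym; case/andP: (nf y oy) => /negPf->.
  - by rewrite f0 f1 => /eqP; rewrite (negPf na_b).
  - by rewrite f1 => /eqP; rewrite eq_sym; case/andP: (nf y oy) => _ /negPf->.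
  - by rewrite f0 => /eqP; case/andP: (nf x ox) => /negPf->.
  - by rewrite f1 => /eqP; case/andP: (nf x ox) => _ /negPf->.
  rewrite !f_off // => eq_f; apply: rho_inj => //.
  by have [_ ->] := rhoE x ox; have [_ ->] := rhoE y oy; rewrite eq_f.
exists (perm f_inj) => k ok; rewrite c3J !permE f0 f1 f_off //.
by have [_] := rhoE k ok.
Qed.

(** The transposition (z0 z1) inverts each generator, and together with them it yields all
    transpositions (z0 y). So the generated group has index at most 2 in the symmetric group, and it
    lies in the alternating group. *)
Lemma star_gen : <<[set star i | i in [pred i | off i]]>> = A.
Proof.
set D := <<_>>; have DA : D \subset A.
  rewrite gen_subG; apply/subsetP=> _ /imsetP[i /= oi ->].
  exact: is_c3_Alt (star_is_c3 oi).
have Dstar i : off i -> star i \in D.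
  by move=> oi; rewrite mem_gen //; apply/imsetP; exists i.
pose t1 := tperm z0 z1.
have nDt1 : <[t1]> \subset 'N(D).
  rewrite cycle_subG inE -genJ gen_subG; apply/subsetP=> _ /imsetP[_ /imsetP[i /= oi ->] ->].
  have Di := star_distinct oi; have [i0 i1] := andP oi.
  have -> : star i ^ t1 = (star i)^-1; last by rewrite groupV Dstar.
  have [_ ->] := c3V Di; have [D' _] := c3V Di; rewrite c3J tpermL tpermR tpermD 1?eq_sym //.
  by rewrite (c3_rot (distinct3_rot (distinct3_rot D'))).
have full : D * <[t1]> = [set: {perm T}].
  rewrite -norm_joinEr //; apply/eqP; rewrite eqEsubset subsetT /= -(gen_tperm z0) gen_subG.
  apply/subsetP=> _ /imsetP[y _ ->].
  have [-> | y0] := eqVneq y z0; first by rewrite tperm1 group1.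
  have [-> | y1] := eqVneq y z1; first by rewrite mem_gen // inE orbC cycle_id.
  have -> : tperm z0 y = t1 * star y by rewrite /star /c3 mulgA tperm2 mul1g.
  rewrite groupM // mem_gen // inE ?cycle_id ?orbT //.
  by rewrite Dstar // /off y0 y1.
apply/eqP; rewrite eqEcard DA /=.
have n2 : 1 < #|T|.
  by have := subset_leq_card (subsetT [set z0; z1]); rewrite cards2 z01 cardsT.
have le_mul : #|D * <[t1]>| <= #|D| * #|<[t1]>|.
  by rewrite mul_cardG leq_pmulr // cardG_gt0.
rewrite -(leq_pmul2l (m := 2)) // card_Alt // -card_Sym mulnC.
rewrite full in le_mul; apply: leq_trans le_mul _.
by rewrite leq_mul2l -orderE dvdn_leq ?orbT // order_dvdn expg2 /t1 tperm2.
Qed.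

End StarGenerators.

End ThreeCycles.

(** By the Frattini argument H = N N_H(R), and H / N is a p-group, so a Sylow p-subgroup P of N_H(R)
    already covers H / N. Write h = u y with u in P, which centralizes R, and y in N. *)
Lemma Frattini_class (gT : finGroupType) (H N R : {group gT}) (p q : nat) x h :
    N <| H -> p.-nat #|H : N| -> q.-Sylow(N) R ->
    (forall P : {group gT}, P \subset 'N_H(R) -> p.-group P -> P \subset 'C(R)) ->
  x \in R -> h \in H -> exists2 y, y \in N & x ^ h = x ^ y.
Proof.
move=> nNH pHN sylR cent Rx Hh.
have [P sylP] := Sylow_exists p 'N_H(R); have [sPN pP _] := and3P sylP.
have cRP := cent _ sPN pP.
have nNNH : 'N_H(R) \subset 'N(N) by rewrite subIset // (normal_norm nNH).
have sylPN := quotient_pHall (subset_trans sPN nNNH) sylP.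
have NHq : 'N_H(R) / N = H / N by rewrite -[in RHS](Frattini_arg nNH sylR) quotientMidl.
have pHq : p.-group (H / N) by rewrite /pgroup card_quotient ?normal_norm.
have PNq : P / N = H / N.
  by rewrite -NHq; apply: pHall_id sylPN _; rewrite /pgroup /= NHq.
have nNP : P \subset 'N(N) := subset_trans sPN nNNH.
have : h \in P * N.
  by rewrite (normC nNP) -quotientK // PNq quotientGK.
case/mulsgP=> u y Pu Ny ->; exists y => //.
by rewrite conjgM; congr (_ ^ _); apply/conjg_fixP/commgP/commute_sym/(centP (subsetP cRP _ Pu)).
Qed.

(** * Automorphisms of the alternating group induced from H *)

Section AltExtension.

Variables (gT : finGroupType) (H N : {group gT}) (T : finType).
Variable f : {morphism N >-> {perm T}}.
Hypotheses (nNH : N <| H) (injf : 'injm f) (fN : f @* N = 'Alt_T).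
Hypotheses (cN1 : 'C_H(N) = 1) (T_gt4 : 4 < #|T|).
Local Notation A := 'Alt_T.
Implicit Types (h x y : gT) (s t w : {perm T}).

Let g := invm injf.

Let gN s : s \in A -> g s \in N.
Proof. by rewrite -fN => As; rewrite -(morphim_invm injf (subxx N)) mem_morphim. Qed.

Let fA x : x \in N -> f x \in A.
Proof. by move=> Nx; rewrite -fN mem_morphim. Qed.

Let gK s : s \in A -> f (g s) = s.
Proof. by rewrite -fN => As; rewrite invmK. Qed.

Let fK x : x \in N -> g (f x) = x.
Proof. by move=> Nx; rewrite /g invmE. Qed.

(** For h in H this is conjugation by h transported to an automorphism of ['Alt_T] along f. *)
Definition conj_Alt h s := f (g s ^ h).

Let NJ h x : h \in H -> x \in N -> x ^ h \in N.
Proof. by move=> Hh Nx; rewrite memJ_norm // (subsetP (normal_norm nNH)). Qed.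

Lemma conj_Alt_in h s : h \in H -> s \in A -> conj_Alt h s \in A.
Proof. by move=> Hh As; rewrite fA // NJ // gN. Qed.

Lemma conj_AltM h s t : h \in H -> s \in A -> t \in A ->
  conj_Alt h (s * t) = conj_Alt h s * conj_Alt h t.
Proof.
move=> Hh As At; rewrite /conj_Alt [g _]morphM ?fN // conjMg morphM ?NJ ?gN //.
Qed.

Lemma conj_Alt_comp h1 h2 s : h1 \in H -> s \in A ->
  conj_Alt h2 (conj_Alt h1 s) = conj_Alt (h1 * h2) s.
Proof. by move=> Hh As; rewrite /conj_Alt fK ?NJ ?gN // conjgM. Qed.

Lemma conj_Alt1 s : s \in A -> conj_Alt 1 s = s.
Proof. by move=> As; rewrite /conj_Alt conjg1 gK. Qed.

Lemma conj_AltK h s : h \in H -> s \in A -> conj_Alt h^-1 (conj_Alt h s) = s.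
Proof. by move=> Hh As; rewrite conj_Alt_comp // mulgV conj_Alt1. Qed.

Lemma conj_Alt_id h : h \in H -> conj_Alt h 1 = 1.
Proof. by move=> Hh; apply: (mulgI (conj_Alt h 1)); rewrite -conj_AltM ?group1 // !mulg1. Qed.

Lemma conj_Alt_inj h : h \in H -> {in A &, injective (conj_Alt h)}.
Proof. by move=> Hh s t As At eq_st; rewrite -(conj_AltK Hh As) eq_st conj_AltK. Qed.

Lemma conj_AltX h s m : h \in H -> s \in A -> conj_Alt h (s ^+ m) = conj_Alt h s ^+ m.
Proof.
by move=> Hh As; elim: m => [|m IHm]; rewrite ?conj_Alt_id // !expgS conj_AltM ?groupX // IHm.
Qed.

Lemma conj_AltV h s : h \in H -> s \in A -> conj_Alt h s^-1 = (conj_Alt h s)^-1.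
Proof.
move=> Hh As; apply: (mulgI (conj_Alt h s)).
by rewrite -conj_AltM ?groupV // !mulgV conj_Alt_id.
Qed.

Lemma conj_Alt_commute h s t : h \in H -> s \in A -> t \in A ->
  commute s t -> commute (conj_Alt h s) (conj_Alt h t).
Proof. by move=> Hh As At cst; rewrite /commute -!conj_AltM // cst. Qed.

Lemma conj_Alt_c3_like h t : h \in H -> t \in A -> c3_like t -> c3_like (conj_Alt h t).
Proof.
move=> Hh At like_t s As cst s3 sJ; have Hh' := groupVr Hh.
have Aw := conj_Alt_in Hh At; have As' := conj_Alt_in Hh' As.
have hK u : u \in A -> conj_Alt h (conj_Alt h^-1 u) = u.
  by move=> Au; rewrite -{1}[h]invgK conj_AltK.
case: (like_t (conj_Alt h^-1 s)) => //.
- by rewrite -(conj_AltK Hh At); apply: conj_Alt_commute.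
- by rewrite -conj_AltX // s3 conj_Alt_id.
- move=> z Az czt; have := sJ (conj_Alt h z) (conj_Alt_in Hh Az) (conj_Alt_commute Hh Az At czt).
  move=> csz; rewrite -{1}(conj_AltK Hh Az).
  have Az' := conj_Alt_in Hh Az.
  have -> : conj_Alt h^-1 s ^ conj_Alt h^-1 (conj_Alt h z) = conj_Alt h^-1 (s ^ conj_Alt h z).
    by rewrite /conjg -conj_AltV // -!conj_AltM ?groupM ?groupV.
  by apply: conj_Alt_commute; rewrite ?groupJ.
- by move=> s1; constructor 1; rewrite -(hK s As) s1 conj_Alt_id.
- by move=> st; constructor 2; rewrite -(hK s As) st.
by move=> sV; constructor 3; rewrite -(hK s As) sV conj_AltV.
Qed.

(** Away from degree 6 the property [c3_like] is invariant and characterizes 3-cycles. In degree 6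
    only p = 5 is possible, and [Frattini_class] for a Sylow 3-subgroup shows that h moves t within
    its N-class. *)
Lemma conj_Alt_is_c3 p h t : prime p -> 3 < p -> p <= #|T| -> p.-nat #|H : N| ->
  h \in H -> is_c3 t -> is_c3 (conj_Alt h t).
Proof.
move=> pr_p p_gt3 p_le pHN Hh t3; have At := is_c3_Alt t3.
have t_n1 : conj_Alt h t != 1.
  apply: contraNneq (is_c3_neq1 t3) => t1; apply/eqP/(conj_Alt_inj Hh) => //.
  by rewrite conj_Alt_id.
have [n6 | n6] := eqVneq #|T| 6; last first.
  apply: c3_like_is_c3; rewrite ?conj_Alt_in //.
    by rewrite -conj_AltX // is_c3_expg3 // conj_Alt_id.
  exact: conj_Alt_c3_like (is_c3_like n6 t3).
have p5 : p = 5.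
  move: p_le; rewrite n6.
  by case: (p) pr_p p_gt3 => [|[|[|[|[|[|[|m]]]]]]].
subst p.
have cardN : #|N| = 360.
  rewrite -(card_injm injf (subxx N)) fN; apply/eqP.
  by rewrite -(eqn_pmul2l (m := 2)) // card_Alt n6.
have : 3.-elt (g t).
  have g3 : g t ^+ 3 = 1.
    have fNt : t \in f @* N by rewrite fN.
    by rewrite /g -morphX // is_c3_expg3 // morph1.
  by rewrite /p_elt (@pnat_dvd _ 3) // order_dvdn g3.
move=> gt3; have Ngt : <[g t]> \subset N by rewrite cycle_subG gN.
have [R sylR sgtR] := Sylow_superset Ngt gt3.
have cardR : #|R| = 9 by rewrite (card_Hall sylR) cardN p_part.
rewrite cycle_subG in sgtR.
have cent (P : {group gT}) : P \subset 'N_H(R) -> 5.-group P -> P \subset 'C(R).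
  rewrite subsetI => /andP[_ nRP] pP.
  have := pgroup_fix_mod pP (_ : [acts P, on R | 'J]); rewrite astabsJ => /(_ nRP).
  rewrite afixJ cardR => mod9.
  have dv : #|'C_R(P)| \in divisors 9 by rewrite -dvdn_divisors // -cardR cardSg ?subsetIl.
  have c9 : #|'C_R(P)| = #|R|.
    by rewrite cardR; move: dv mod9; rewrite !inE => /or3P[] /eqP->.
  have <- : 'C_R(P) = R by apply/eqP; rewrite eqEcard subsetIl c9 /=.
  by rewrite centsC subsetIr.
have [y Ny ghy] := Frattini_class nNH pHN sylR cent sgtR Hh.
by rewrite /conj_Alt ghy morphJ ?gN // gK //; apply: is_c3J.
Qed.

(** Since h acts as conjugation by some s, the element h^2 differs from the preimage of the even
    permutation s^2 by an element centralizing N, hence trivial. So the coset of h has order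
    dividing both 2 and the odd number |H : N|. *)
Lemma Alt_odd_extension p : prime p -> 3 < p -> p <= #|T| -> p.-nat #|H : N| -> H :=: N.
Proof.
move=> pr_p p_gt3 p_le pHN; apply/eqP; rewrite eqEsubset (normal_sub nNH) andbT.
apply/subsetP=> h Hh.
have [z0 [z1 [_ _ z01]]] : exists z0 z1 : T, [/\ z0 \in T, z1 \in T & z0 != z1].
  by apply/card_gt1P; apply: leq_trans T_gt4.
have [s sP] : exists s : {perm T}, forall i, off z0 z1 i -> conj_Alt h (star z0 z1 i) = star z0 z1 i ^ s.
  have AS i : off z0 z1 i -> star z0 z1 i \in A by move/(star_is_c3 z01)/is_c3_Alt.
  apply: (star_family z01 T_gt4).
  - by move=> i /(star_is_c3 z01); apply: conj_Alt_is_c3 pHN Hh.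
  - move=> i j oi oj ij; have [m2 m1] := star_mul z01 oi oj ij.
    have Aij : star z0 z1 i * star z0 z1 j \in A by rewrite groupM ?AS.
    rewrite -conj_AltM ?AS // -conj_AltX // m2 conj_Alt_id //; split=> //.
    apply: contraNneq m1 => t1; apply/eqP/(conj_Alt_inj Hh) => //.
    by rewrite conj_Alt_id.
  by move=> i j oi oj /(conj_Alt_inj Hh (AS i oi) (AS j oj)); apply: star_inj.
have conjE w : w \in A -> conj_Alt h w = w ^ s.
  pose K := [set w in A | conj_Alt h w == w ^ s].
  have grK : group_set K.
    apply/group_setP; split; first by rewrite inE group1 conj_Alt_id // conj1g /=.
    move=> u v /setIdP[Au /eqP hu] /setIdP[Av /eqP hv].
    by rewrite inE groupM // conj_AltM // hu hv conjMg /=.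
  rewrite -(star_gen z01) => Aw; apply/eqP; suff /setIdP[] : w \in Group grK by [].
  move: w Aw; apply/subsetP; rewrite gen_subG; apply/subsetP=> _ /imsetP[i /= oi ->].
  by rewrite inE (is_c3_Alt (star_is_c3 z01 oi)) sP //=.
have As2 : s ^+ 2 \in A by rewrite Alt_even odd_permM addbb.
have Nh2 : h ^+ 2 \in N.
  have Nu := gN As2; set u := g (s ^+ 2) in Nu.
  rewrite -(mulgKV u (h ^+ 2)) groupM //.
  suff : h ^+ 2 * u^-1 \in 'C_H(N) by rewrite cN1 => /set1P->; apply: group1.
  have Hu := subsetP (normal_sub nNH) _ Nu.
  rewrite inE groupM ?groupX ?groupV //=; apply/centP=> x Nx; apply/esym/commgP/conjg_fixP.
  apply: (can_in_inj fK); rewrite ?NJ // ?groupM ?groupX ?groupV //.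
  have fJ y : y \in N -> f (y ^ h) = f y ^ s.
    by move=> Ny; rewrite -conjE ?fA // /conj_Alt fK.
  rewrite conjgM expg2 conjgM morphJ ?groupV ?NJ // morphV // gK // !fJ ?NJ //.
  by rewrite expg2 invMg conjgM !conjgK.
have nNh := subsetP (normal_norm nNH) _ Hh.
rewrite coset_idr //; apply/eqP; rewrite -order_eq1 -dvdn1.
have <- : gcdn 2 #|H / N| = 1%N.
  apply/eqP; rewrite -/(coprime _ _) card_quotient ?normal_norm //.
  rewrite coprime_sym; apply: pnat_coprime pHN _.
  by rewrite pnatE // !inE ltn_eqF // ltnW.
rewrite dvdn_gcd; apply/andP; split; last by rewrite order_dvdG ?mem_quotient.
by rewrite order_dvdn -morphX //= coset_id.
Qed.

End AltExtension.

Lemma gsocle_normal (gT : finGroupType) (H : {group gT}) : gsocle H <| H.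
Proof.
apply/andP; split; first by rewrite gen_subG; apply/bigcupsP=> M /andP[].
rewrite norms_gen // norms_bigcup //; apply/bigcapsP=> M /andP[_ /mingroupP[]].
by case/andP.
Qed.

(** A nontrivial centralizer would contain a minimal normal subgroup of H; this lies in the socle
    and centralizes it. *)
Lemma cent_gsocle (gT : finGroupType) (H : {group gT}) :
  'Z(gsocle H) = 1 -> 'C_H(gsocle H) = 1.
Proof.
move=> Z1; apply/eqP/idPn=> ntC.
have nCH : H \subset 'N('C_H(gsocle H)).
  by rewrite normsI ?normG // norms_cent // normal_norm // gsocle_normal.
have [M minM sMC] := minnormal_exists ntC nCH.
have [sMH cM] := subsetIP sMC; have /mingroupP[/andP[ntM _] _] := minM.
case/negP: ntM; rewrite -subG1 -Z1 subsetI cM andbT.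
by apply/sub_gen/(bigcup_max M) => //; rewrite sMH.
Qed.

Lemma center_simple (gT : finGroupType) (G : {group gT}) :
  simple G -> ~~ abelian G -> 'Z(G) = 1.
Proof.
by move=> /simpleP[_ simG] nab; case: (simG _ (center_normal G)) => // /center_idP; rewrite (negPf nab).
Qed.

(** An abelian simple group has prime order, but both 3 and p divide the order here. *)
Lemma Alt_nonabelian (T : finType) p : prime p -> 3 < p -> p %| #|'Alt_T| -> 4 < #|T| ->
  ~~ abelian 'Alt_T.
Proof.
move=> pr_p p_gt3 p_dv T_gt4; apply/negP=> /abelian_sol/simple_sol_prime/(_ (simple_Alt5 T_gt4)) prA.
have : 3 %| 2 * #|'Alt_T| by rewrite card_Alt ?dvdn_fact // ltnW // ltnW // ltnW.
rewrite (Gauss_dvdr _ (isT : coprime 3 2)).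
move: p_dv; rewrite !(dvdn_prime2 _ prA) // => /eqP<- /eqP p3.
by rewrite -p3 in p_gt3.
Qed.

Lemma prime_dvdn_fact p n : prime p -> p %| n`! -> p <= n.
Proof.
move=> pr_p; elim: n => [|n IHn]; first by rewrite Euclid_dvd1.
rewrite factS Euclid_dvdM // => /orP[/dvdn_leq-> // | /IHn]; exact: leqW.
Qed.

Local Open Scope ring_scope.

(** * Character congruences and the principal block *)

Section Reduction.

Variables (p : nat) (F : fieldType) (red : algC -> F).
Hypothesis redP : modular_reduction p red.

Let pF : p \in [pchar F]. Proof. by case: redP. Qed.
Let red1 : red 1 = 1. Proof. by case: redP. Qed.
Let redD : {in Aint &, {morph red : x y / x + y}}. Proof. by case: redP. Qed.
Let redM : {in Aint &, {morph red : x y / x * y}}. Proof. by case: redP. Qed.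

Lemma red0 : red 0 = 0.
Proof. by apply: (addrI (red 0)); rewrite -redD ?rpred0 // !addr0. Qed.

Lemma redN : {in Aint, {morph red : x / - x}}.
Proof.
move=> x Ax; apply: (addrI (red x)).
by rewrite -redD ?rpredN // !subrr red0.
Qed.

Lemma red_sum (I : Type) (s : seq I) (P : pred I) (E : I -> algC) :
  (forall i, P i -> E i \in Aint) ->
  red (\sum_(i <- s | P i) E i) = \sum_(i <- s | P i) red (E i).
Proof.
move=> AE; elim: s => [|i s IHs]; first by rewrite !big_nil red0.
rewrite !big_cons; case: ifP => // Pi.
by rewrite redD ?IHs ?AE ?rpred_sum.
Qed.

Lemma redX n : {in Aint, {morph red : x / x ^+ n}}.
Proof.
move=> x Ax; elim: n => [|n IHn]; first by rewrite !expr0 red1.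
by rewrite !exprS redM ?rpredX // IHn.
Qed.

Lemma red_nat n : red n%:R = n%:R.
Proof.
elim: n => [|n IHn]; first exact: red0.
by rewrite -addn1 !natrD redD ?rpred_nat ?rpred1 // IHn red1.
Qed.

Lemma red_int m : red m%:~R = m%:~R.
Proof.
case: m => n; first exact: red_nat.
by rewrite NegzE !mulrNz redN ?rpred_int // red_nat.
Qed.

Lemma red_Cint_eq0 x : x \in Num.int -> (red x == 0) = (p %| x)%C.
Proof.
case/intrP=> m ->; rewrite red_int dvdC_int ?intr_int // intrKfloor.
suff: (m%:~R == 0 :> F) = (`|m|%:R == 0 :> F) by rewrite -(dvdn_pcharf pF).
by case: m => n //; rewrite NegzE mulrNz oppr_eq0 abszN.
Qed.

End Reduction.

Section Block.

Variables (p : nat) (F : fieldType) (red : algC -> F).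
Hypothesis redP : modular_reduction p red.
Variables (gT : finGroupType) (G : {group gT}).

Local Notation N := #|classes G|.
Local Notation a := (@gring_classM_coef gT G).

Let r (i : Iirr G) (k : 'I_N) : F := red 'omega_i['K_k].
(** [ev i] is the central character of ['chi_i] modulo ker red, as a linear form on the center of
    F[G], with v listing coordinates on the class sums. *)
Let ev i (v : {ffun 'I_N -> F}) : F := \sum_k v k * r i k.

Let rM i j k : r i j * r i k = \sum_l (a j k l)%:R * r i l.
Proof.
have [_ _ redD redM _] := redP.
have A := Aint_gring_mode_class_sum i.
rewrite /r -redM // -gring_irr_modeM ?gring_class_sum_central //.
rewrite gring_classM_expansion raddf_sum /= (red_sum redP) => [|l _]; last first.
  by rewrite xcfunZr rpredM ?rpred_nat.
by apply: eq_bigr => l _; rewrite xcfunZr redM ?rpred_nat // (red_nat redP).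
Qed.

Let evM v w : exists u : {ffun 'I_N -> F}, forall i, ev i u = ev i v * ev i w.
Proof.
exists [ffun l => \sum_j \sum_k v j * w k * (a j k l)%:R] => i.
rewrite /ev big_distrlr /=.
under eq_bigr do rewrite ffunE mulr_suml.
rewrite exchange_big /=; apply: eq_bigr => j _.
under eq_bigr do rewrite mulr_suml.
rewrite exchange_big /=; apply: eq_bigr => k _.
rewrite mulrACA rM mulr_sumr; apply: eq_bigr => l _.
by rewrite mulrA.
Qed.

Let delta (k : 'I_N) (x : F) : {ffun 'I_N -> F} := [ffun l => x *+ (l == k)].

Let ev_delta i k x : ev i (delta k x) = x * r i k.
Proof.
rewrite /ev (bigD1 k) //= ffunE eqxx big1 ?addr0 // => l /negPf lk.
by rewrite ffunE lk mul0r.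
Qed.

Let evB i (v w : {ffun 'I_N -> F}) : ev i [ffun k => v k - w k] = ev i v - ev i w.
Proof.
by rewrite /ev -sumrB; apply: eq_bigr => k _; rewrite ffunE mulrBl.
Qed.

Let evZ i x (v : {ffun 'I_N -> F}) : ev i [ffun k => x * v k] = x * ev i v.
Proof.
by rewrite /ev mulr_sumr; apply: eq_bigr => k _; rewrite ffunE mulrA.
Qed.

Let k1 : 'I_N := enum_rank_in (classes1 G) (1%g : {set gT}).

Let ev1 i : ev i (delta k1 1) = 1.
Proof.
rewrite ev_delta mul1r /r (@gring_mode_class_sum_eq _ _ _ _ 1%g); last first.
  by rewrite enum_rankK_in ?classes1 // set11.
rewrite class1G cards1 mul1r divff ?irr1_neq0 //; by case: redP.
Qed.

(** For each i outside the principal block, choose a class k on which the central characters of i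
    and of 1_G differ; v is the product of the central elements (K_k - r i k) / (r 0 k - r i k). It
    plays the role of the principal block idempotent. *)
Let separate (s : seq (Iirr G)) : exists v, ev 0 v = 1 /\
  forall i, i \in s -> i \notin principal_block red G -> ev i v = 0.
Proof.
elim: s => [|i s [v [v0 vs]]]; first by exists (delta k1 1).
have [iB | ] := boolP (i \in principal_block red G).
  exists v; split=> // j; rewrite inE => /predU1P[-> | /vs//].
  by rewrite iB.
rewrite inE negb_forall => /existsP[k neq_k].
have neq_r : r 0 k - r i k != 0 by rewrite subr_eq0 eq_sym.
pose w := [ffun l => (r 0 k - r i k)^-1
             * [ffun l' => delta k 1 l' - delta k1 (r i k) l'] l].
have ev_w j : ev j w = (r j k - r i k) / (r 0 k - r i k).
  rewrite evZ evB !ev_delta mul1r mulrC; congr ((_ - _) / _).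
  by rewrite -[r j k1]mul1r -(ev_delta j k1) ev1 mulr1.
have [u ev_u] := evM v w; exists u; split.
  by rewrite ev_u v0 ev_w mul1r divff.
move=> j; rewrite inE => /predU1P[-> _ | /vs vj /vj {}vj].
  by rewrite ev_u ev_w subrr mul0r mulr0.
by rewrite ev_u vj mul0r.
Qed.

(* The hypothesis says that the class sums act through theta modulo ker red   *)
(* as they do through theta(1) copies of the trivial character; central       *)
(* characters of distinct blocks being linearly independent modulo ker red,   *)
(* the constituents in the principal block must then account for theta(1).    *)
Lemma p'_principal_block_constituent (theta : 'CF(G)) :
    theta \in 'Z[irr G] -> ~~ (p %| theta 1%g)%C ->
    {in G, forall x, ~~ (p %| #|x ^: G|)%N -> red (theta x) = red (theta 1%g)} ->
  exists2 i, i \in p'_principal_block p red G & '[theta, 'chi_i] != 0.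
Proof.
have [pF red1 redD redM _] := redP.
move=> Ztheta p'theta theta_const.
pose m i : algC := '[theta, 'chi_i].
have Zm i : m i \in Num.int by rewrite Cint_cfdot_vchar_irr.
have Am i : m i \in Aint by rewrite Aint_Cint.
have Atheta x : theta x \in Aint by apply: Aint_vchar.
have Achi i : 'chi[G]_i 1%g \in Aint by apply: Aint_irr.
have Dtheta : theta = \sum_i m i *: 'chi_i by apply: cfun_sum_cfdot.
(* Before reduction, the left side is theta(x) times the size of the class of x. If p divides that
   size, both sides vanish; otherwise the hypothesis on theta applies. *)
have key k : \sum_i red (m i * 'chi_i 1%g) * r i k = red (theta 1%g) * r 0 k.
  have /imsetP[x Gx Dk] := enum_valP k.
  have kx : x \in enum_val k by rewrite Dk class_refl.
  transitivity (red (\sum_i m i * 'chi_i x * #|x ^: G|%:R)).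
    rewrite (red_sum redP) => [|i _]; last first.
      by apply: rpredM (rpredM (Am i) (Aint_irr i x)) (rpred_nat _ _).
    apply: eq_bigr => i _.
    rewrite -redM ?Aint_gring_mode_class_sum ?(rpredM (Am i) (Achi i)) //; congr red.
    rewrite (gring_mode_class_sum_eq i kx) -(mulrA (m i)) (mulrC ('chi_i 1%g)).
    by rewrite divfK ?irr1_neq0 // mulrCA mulrC.
  rewrite -mulr_suml.
  have -> : \sum_i m i * 'chi_i x = theta x.
    by rewrite [theta]Dtheta sum_cfunE; apply: eq_bigr => i _; rewrite cfunE.
  rewrite redM ?rpred_nat // /r (gring_mode_class_sum_eq 0 kx).
  rewrite irr0 !cfun1E Gx group1 divr1 mulr1 (red_nat redP).
  have [px | /theta_const-> //] := boolP (p %| #|x ^: G|)%N.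
  have -> : #|x ^: G|%:R = 0 :> F by apply/eqP; rewrite -(dvdn_pcharf pF).
  by rewrite !mulr0.
have [v [v0 v_other]] := separate (enum {: Iirr G}).
have sum_ev : \sum_i red (m i * 'chi_i 1%g) * ev i v = red (theta 1%g).
  rewrite -[RHS]mulr1 -v0 /ev mulr_sumr.
  under eq_bigr do rewrite mulr_sumr.
  rewrite exchange_big /=; apply: eq_bigr => k _.
  rewrite mulrCA -key mulr_sumr; apply: eq_bigr => i _.
  by rewrite mulrCA.
have nz_theta : red (theta 1%g) != 0.
  by rewrite (red_Cint_eq0 redP) ?Cint_vchar1.
(* Applying v to [key] leaves only principal block terms, of sum red (theta 1) != 0. A nonzero term
   m i * chi_i(1) gives both the multiplicity and the p'-degree. *)
have [i /andP[iB nz_i]] :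
    exists i, (i \in principal_block red G) && (red (m i * 'chi_i 1%g) != 0).
  apply/existsP; apply: contraNT nz_theta => /existsPn no_i.
  rewrite -sum_ev big1 // => i _.
  have := no_i i; have [_ /= | i'B _] := boolP (i \in _).
    by rewrite negbK => /eqP->; rewrite mul0r.
  by rewrite v_other ?mem_enum ?mulr0.
exists i; last first.
  by apply: contraNneq nz_i; rewrite -/(m i) => ->; rewrite mul0r (red0 redP).
rewrite inE iB -(red_Cint_eq0 redP) ?Cint_vchar1 ?irr_vchar //.
by apply: contraNneq nz_i => nz_i; rewrite redM // nz_i mulr0.
Qed.

End Block.

(** * Reduction of representations modulo a prime *)

Lemma Aint_integralOver x : (x \in Aint) <-> integralOver (intr : int -> algC) x.
Proof.
split=> [Ax | [q mon_q qx0]]; last first.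
  apply: (root_monic_Aint qx0). exact: monic_map mon_q.
  by apply/polyOverP=> i; rewrite coef_map /= intr_int.
have [q Dq] := floorpP Ax; exists q; last by rewrite -Dq root_minCpoly.
have [r [Dr mon_r] _] := minCpolyP x.
have: minCpoly x \is monic by rewrite Dr monic_map.
rewrite Dq !monicE lead_coef_map_inj //; last exact: intr_inj.
by rewrite -(inj_eq (@intr_inj algC)).
Qed.

(** If f has degree n + 1 and leading coefficient l, then l^n f(x) is a monic polynomial in l x with
    coefficients in [Aint]. *)
Lemma Aint_lead_coefM (f : {poly algC}) x :
  f \is a polyOver Aint -> f != 0 -> root f x -> lead_coef f * x \in Aint.
Proof.
move=> /polyOverP Af nz_f fx0; set l := lead_coef f.
have [n szf] : exists n, size f = n.+2.
  case: (size f) (root_size_gt1 nz_f fx0) => [|[|n]] // _.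
  by exists n.
pose h := \poly_(i < n.+1) (f`_i * l ^+ (n - i)).
pose g := 'X^(n.+1) + h.
have sz_h : (size h < size ('X^(n.+1) : {poly algC}))%N.
  by rewrite size_polyXn ltnS size_poly.
have mon_g : g \is monic by rewrite monicE lead_coefDl ?lead_coefXn.
have g0 : root g (l * x).
  apply/eqP; transitivity (l ^+ n * f.[x]); last by rewrite (eqP fx0) mulr0.
  rewrite hornerD hornerXn horner_poly [f.[x]]horner_coef szf [in RHS]big_ord_recr /=.
  have <- : l = f`_n.+1 by rewrite /l lead_coefE szf.
  rewrite mulrDr mulrA -exprSr exprMn addrC; congr (_ + _).
  rewrite mulr_sumr; apply: eq_bigr => i _.
  have -> : l ^+ n = l ^+ (n - i) * l ^+ i.
    by rewrite -exprD subnK // -ltnS.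
  by rewrite exprMn -!mulrA mulrCA; congr (_ * _); rewrite mulrCA.
apply/Aint_integralOver; apply: integral_root_monic mon_g g0 _.
move=> _ /(nthP 0)[i _ <-]; apply/Aint_integralOver.
rewrite coefD coefXn coef_poly rpredD ?rpred_nat //.
by case: ifP => _; rewrite ?rpred0 // rpredM ?rpredX ?Af.
Qed.

Lemma char_poly_conj (K : fieldType) n (B A : 'M[K]_n) : B \in unitmx ->
  char_poly (B *m A *m invmx B) = char_poly A.
Proof.
move=> uB; pose mC := map_mx (@polyC K).
have -> : char_poly (B *m A *m invmx B) =
          \det (mC _ _ B *m char_poly_mx A *m mC _ _ (invmx B)).
  rewrite /char_poly; congr (\det _).
  rewrite /char_poly_mx !map_mxM mulmxBr mulmxBl; congr (_ - _).
  by rewrite scalar_mxC -mulmxA -map_mxM mulmxV // map_mx1 mulmx1.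
rewrite !det_mulmx mulrAC -det_mulmx -map_mxM mulmxV //.
by rewrite map_mx1 det1 mul1r.
Qed.

(** * The valuation ring above p and invariant lattices *)

Section Localization.

Variables (p : nat) (F : fieldType) (red : algC -> F).
Hypothesis redP : modular_reduction p red.

Let redD : {in Aint &, {morph red : x y / x + y}}. Proof. by case: redP. Qed.
Let redM : {in Aint &, {morph red : x y / x * y}}. Proof. by case: redP. Qed.
Let red_1 : red 1 = 1. Proof. by case: redP. Qed.
Let red_0 : red 0 = 0. Proof. exact: red0 redP. Qed.

Definition is_fraction (x : algC) (ab : algC * algC) :=
  [/\ ab.1 \in Aint, ab.2 \in Aint, red ab.2 != 0 & x = ab.1 / ab.2].

(** The localization of [Aint] at the maximal ideal ker red. *)
Definition local_ring : {pred algC} := fun x => `[< exists ab, is_fraction x ab >].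

Let den_neq0 b : red b != 0 -> b != 0.
Proof. by apply: contraNneq => ->; rewrite red_0. Qed.

Lemma local_ringP x : reflect (exists ab, is_fraction x ab) (x \in local_ring).
Proof. exact: asboolP. Qed.

Lemma Aint_fraction x : x \in Aint -> is_fraction x (x, 1).
Proof. by split; rewrite ?rpred1 ?red_1 ?oner_eq0 ?divr1. Qed.

Lemma Aint_local : {subset Aint <= local_ring}.
Proof. by move=> x Ax; apply/local_ringP; exists (x, 1); apply: Aint_fraction. Qed.

Lemma fractionB x y a b c d : is_fraction x (a, b) -> is_fraction y (c, d) ->
  is_fraction (x - y) (a * d - c * b, b * d).
Proof.
move=> [/= Aa Ab nb ->] [/= Ac Ad nd ->]; split=> /=.
- by rewrite rpredB ?rpredM.
- by rewrite rpredM.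
- by rewrite redM ?mulf_neq0.
by rewrite -mulNr addf_div ?den_neq0 // mulNr.
Qed.

Lemma fractionM x y a b c d : is_fraction x (a, b) -> is_fraction y (c, d) ->
  is_fraction (x * y) (a * c, b * d).
Proof.
move=> [/= Aa Ab nb ->] [/= Ac Ad nd ->].
by split; rewrite /= ?rpredM // ?redM ?mulf_neq0 // mulf_div.
Qed.

Lemma local_subring : subring_closed local_ring.
Proof.
split=> [|x y /local_ringP[[a b] x_ab] /local_ringP[[c d] y_cd]|
          x y /local_ringP[[a b] x_ab] /local_ringP[[c d] y_cd]].
- exact/Aint_local/rpred1.
- by apply/local_ringP; exists (a * d - c * b, b * d); apply: fractionB.
- by apply/local_ringP; exists (a * c, b * d); apply: fractionM.
Qed.

HB.instance Definition _ := GRing.isSubringClosed.Build algC local_ring local_subring.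

Record local_type := Local { local_val :> algC; localP : local_val \in local_ring }.

HB.instance Definition _ := [isSub for local_val].
HB.instance Definition _ := [Choice of local_type by <:].
HB.instance Definition _ := [SubChoice_isSubComNzRing of local_type by <:].

Local Notation O := local_type.
Implicit Types x y : O.

Let frac x := projT1 (cid (elimT (local_ringP _) (localP x))).

Let fracP x : is_fraction (val x) (frac x).
Proof. exact: projT2 (cid (elimT (local_ringP _) (localP x))). Qed.

Definition residue x : F := red (frac x).1 / red (frac x).2.

Lemma residueE x a b : is_fraction (val x) (a, b) -> residue x = red a / red b.
Proof.
rewrite /residue; case: (frac x) (fracP x) => c d [/= Ac Ad nd ->] [/= Aa Ab nb].
move/eqP; rewrite eqr_div ?den_neq0 // => /eqP eq_abcd.
by apply/eqP; rewrite eqr_div // -!redM // eq_abcd.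
Qed.

Lemma residue_Aint x : val x \in Aint -> residue x = red (val x).
Proof. by move/Aint_fraction/residueE->; rewrite red_1 divr1. Qed.

Lemma residue_zmod_morphism : zmod_morphism residue.
Proof.
move=> x y; move: (fracP x) (fracP y).
rewrite /residue; case: (frac x) => a b; case: (frac y) => c d /= x_ab y_cd.
have xy_f : is_fraction (val (x - y)) (a * d - c * b, b * d).
  by rewrite rmorphB; apply: fractionB.
rewrite -/(residue _) (residueE xy_f).
case: x_ab y_cd => [/= Aa Ab nb _] [/= Ac Ad nd _].
rewrite redD ?rpredN ?rpredM // (redN redP) ?rpredM // !redM //.
by rewrite -[in RHS]mulNr addf_div // mulNr.
Qed.

Lemma residue_monoid_morphism : monoid_morphism residue.
Proof.
split=> [|x y]; first by rewrite residue_Aint ?rmorph1 // ?rpred1.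
move: (fracP x) (fracP y).
rewrite /residue; case: (frac x) => a b; case: (frac y) => c d /= x_ab y_cd.
have xy_f : is_fraction (val (x * y)) (a * c, b * d).
  by rewrite rmorphM; apply: fractionM.
rewrite -/(residue _) (residueE xy_f).
case: x_ab y_cd => [/= Aa Ab nb _] [/= Ac Ad nd _].
by rewrite !redM // mulf_div.
Qed.

HB.instance Definition _ := GRing.isZmodMorphism.Build O F residue residue_zmod_morphism.
HB.instance Definition _ := GRing.isMonoidMorphism.Build O F residue residue_monoid_morphism.

(* Kept opaque: simplification would otherwise lose the morphism structure.   *)
Fact local_incl_subproof : {v : {rmorphism O -> algC} | v =1 val}.
Proof. by exists val. Qed.
Definition local_incl : {rmorphism O -> algC} := sval local_incl_subproof.
Lemma local_inclE x : local_incl x = val x.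
Proof. by rewrite /local_incl; case: local_incl_subproof. Qed.

Lemma local_incl_inj : injective local_incl.
Proof. by move=> x y; rewrite !local_inclE => /val_inj. Qed.

Local Notation valp := (map_poly local_incl).
Local Notation resp := (map_poly residue).

Let val_eq0 x : (val x == 0) = (x == 0).
Proof. exact: inj_eq (@val_inj _ _ O) x 0. Qed.

Lemma local_inv x : residue x != 0 -> (val x)^-1 \in local_ring.
Proof.
move: (fracP x); rewrite /residue; case: (frac x) => a b /= [/= Aa Ab nb ->] nz.
apply/local_ringP; exists (b, a); split=> //=; last by rewrite invf_div.
by apply: contraNneq nz => ->; rewrite mul0r.
Qed.

Lemma common_denominator (s : seq O) :
  exists b, [/\ b \in Aint, red b != 0 & {in s, forall x, b * val x \in Aint}].
Proof.
elim: s => [|x s [b [Ab nb bs]]]; first by exists 1; rewrite red_1 oner_eq0.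
have := fracP x; case: (frac x) => c d [/= Ac Ad nd x_cd].
exists (b * d); split=> [||y]; first exact: rpredM.
  by rewrite redM // mulf_neq0.
rewrite inE => /predU1P[-> | /bs Aby]; last by rewrite mulrAC rpredM.
by rewrite x_cd -mulrA (mulrC d) divfK ?den_neq0 // rpredM.
Qed.

(** A common denominator b of the coefficients, with red b != 0, reduces this to
    [Aint_lead_coefM]. *)
Lemma local_lead_coefM (f : {poly O}) (z : algC) :
  f != 0 -> root (valp f) z -> val (lead_coef f) * z \in local_ring.
Proof.
move=> nz_f fz0; have [b [Ab nb bf]] := common_denominator f.
have szf : size (b *: valp f) = size f.
  by rewrite size_scale ?den_neq0 // size_map_inj_poly ?rmorph0 //; apply: local_incl_inj.
have A_bf : b *: valp f \is a polyOver Aint.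
  apply/polyOverP=> i; rewrite coefZ coef_map /= local_inclE.
  have [lt_i | le_i] := ltnP i (size f); first exact/bf/mem_nth.
  by rewrite nth_default // mulr0 rpred0.
have := Aint_lead_coefM A_bf _ (_ : root _ z).
rewrite -size_poly_eq0 szf size_poly_eq0 nz_f rootZ ?den_neq0 // fz0.
rewrite lead_coefZ lead_coef_map_inj ?rmorph0 //; last exact: local_incl_inj.
rewrite local_inclE.
move/(_ isT isT) => A_bcz; apply/local_ringP.
exists (b * val (lead_coef f) * z, b); split=> //=.
by rewrite -[in RHS](mulrA b) [RHS]mulrC mulKf ?den_neq0 //.
Qed.

(* The valuation ring property, by induction on the size of f: either the     *)
(* leading coefficient of f is a unit and z is integral over the local ring,  *)
(* or its leading term can be absorbed in the next one.                       *)
Lemma local_or_inv (f : {poly O}) (z : algC) :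
  resp f != 0 -> root (valp f) z -> z \in local_ring \/ z^-1 \in local_ring.
Proof.
have [n] := ubnP (size f); elim: n f => // n IHn f /ltnSE-le_f_n nz_rf fz0.
have nz_f : f != 0 by apply: contraNneq nz_rf => ->; rewrite rmorph0.
have lz_loc := local_lead_coefM nz_f fz0.
have [rc0 | nz_rc] := eqVneq (residue (lead_coef f)) 0; last first.
  left; rewrite -[z](mulKf (_ : val (lead_coef f) != 0)).
    by rewrite rpredM // local_inv.
  by rewrite val_eq0; apply: contraNneq nz_rc => ->; rewrite rmorph0.
pose y := Local lz_loc.
have [m szf] : exists m, size f = m.+2.
  have := root_size_gt1 _ fz0.
  rewrite -size_poly_eq0 size_map_inj_poly ?size_poly_eq0 ?rmorph0 //; last exact: local_incl_inj.
  by case: (size f) => [|[|m]] /(_ nz_f) // _; exists m.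
(* With y = lead_coef f * z, the leading term c X^(m+1) is traded for y X^m without changing the
   value at z. *)
pose g := f - lead_coef f *: 'X^(m.+1) + y *: 'X^m.
have Drg : resp g = resp f + residue y *: 'X^m.
  by rewrite rmorphD rmorphB /= !map_polyZ !map_polyXn /= rc0 scale0r subr0.
have gz0 : root (valp g) z.
  apply/eqP; rewrite /g rmorphD rmorphB /= !map_polyZ !map_polyXn !hornerE.
  by rewrite (eqP fz0) sub0r !local_inclE /= exprS mulrA addNr.
have [rg0 | nz_rg] := eqVneq (resp g) 0; last first.
  apply: IHn nz_rg gz0; apply: leq_trans le_f_n; rewrite szf ltnS.
  apply/leq_sizeP => j lt_mj; rewrite !coefE.
  rewrite -[m.+1]/(m.+2.-1) -szf.
  have [-> | ne_j] := eqVneq j (size f).-1.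
    by rewrite -lead_coefE mulr1 subrr szf gtn_eqF ?mulr0 ?addr0.
  rewrite mulr0 subr0 (gtn_eqF lt_mj) mulr0 addr0 nth_default // szf.
  by rewrite ltn_neqAle lt_mj eq_sym andbT -[m.+1]/(m.+2.-1) -szf.
(* When g reduces to 0, f reduces to - y X^m, so y is a unit and z^-1 = lead_coef f / y. *)
have nz_ry : residue y != 0.
  apply: contraNneq nz_rf => ry0.
  by rewrite -rg0 Drg ry0 scale0r addr0.
right; have [-> | nz_z] := eqVneq z 0; first by rewrite invr0 rpred0.
have nz_c : val (lead_coef f) != 0.
  by rewrite val_eq0 lead_coef_eq0.
have -> : z^-1 = val (lead_coef f) * (val y)^-1.
  by rewrite /= invfM mulVKf.
by rewrite rpredM ?localP ?local_inv.
Qed.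

(** An algebraic number is a root of a primitive integer polynomial, and primitivity makes its
    reduction modulo p nonzero. *)
Lemma local_total (z : algC) : z \in local_ring \/ z^-1 \in local_ring.
Proof.
have [pF _ _ _ _] := redP.
have [q [Dq mon_q] _] := minCpolyP z.
have [f [c nz_c Df]] := rat_poly_scale q.
have nz_f : f != 0.
  by apply: contraTneq mon_q => f0; rewrite Df f0 rmorph0 scaler0 monicE lead_coef0 eq_sym oner_eq0.
pose g := map_poly (intr : int -> O) (zprimitive f).
apply: (@local_or_inv g).
  apply/eqP=> rg0; have : (p%:Z %| zcontents (zprimitive f))%Z.
    rewrite dvdz_contents; apply/polyOverP=> i.
    have := congr1 (fun h : {poly F} => h`_i) rg0.
    rewrite coef0 !coef_map /= rmorph_int => /eqP.
    have <- := red_int redP; rewrite (red_Cint_eq0 redP) ?intr_int //.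
    by rewrite dvdC_int ?intr_int // intrKfloor.
  rewrite zcontents_primitive nz_f dvdz1 => /eqP p1.
  by have := pcharf_prime pF; rewrite -[p]/(`|p%:Z|%N) p1.
have -> : valp g = map_poly (intr : int -> algC) (zprimitive f).
  by rewrite -map_poly_comp; apply: eq_map_poly => m /=; rewrite rmorph_int.
have: root (map_poly (intr : int -> algC) f) z.
  have := root_minCpoly z; rewrite Dq Df map_polyZ rootZ; last first.
    by rewrite fmorph_eq0 invr_eq0 intr_eq0.
  rewrite -map_poly_comp; congr (root _ z).
  by apply: eq_map_poly => m /=; rewrite rmorph_int.
rewrite {1}(zpolyEprim f) map_polyZ rootZ //.
by rewrite intr_eq0 zcontents_eq0.
Qed.

(** Divisibility is total in a valuation ring, so a finite family has a member dividing all the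
    others. *)
Lemma local_max (s : seq algC) : has (fun d => d != 0) s ->
  exists2 d, d \in s & d != 0 /\ {in s, forall e, e / d \in local_ring}.
Proof.
elim: s => //= d s IHs; case: (boolP (has _ s)) => [/IHs[e es [nz_e max_e]] _ | no_s].
  case: (local_total (d / e)) => [de | ed]; first exists e.
  - by rewrite inE es orbT.
  - by split=> // f; rewrite inE => /predU1P[-> | /max_e].
  have [d0 | nz_d] := eqVneq d 0; first exists e.
  - by rewrite inE es orbT.
  - by split=> // f; rewrite inE => /predU1P[-> | /max_e//]; rewrite d0 mul0r rpred0.
  exists d; first exact: mem_head.
  split=> // f; rewrite inE => /predU1P[-> | /max_e fe]; first by rewrite divff // rpred1.
  have -> : f / d = f / e * (d / e)^-1 by rewrite invf_div mulrA divfK.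
  exact: rpredM.
rewrite orbF => nz_d; exists d; first exact: mem_head.
split=> // f; rewrite inE => /predU1P[-> | sf]; first by rewrite divff // rpred1.
have /eqP-> : f == 0 by apply: contraNT no_s => nz_f; apply/hasP; exists f.
by rewrite mul0r rpred0.
Qed.

Lemma cramer n (B : 'M[algC]_n) (w : 'rV_n) k : B \in unitmx ->
  (w *m invmx B) 0 k = \det (\matrix_i (if i == k then w else row i B)) / \det B.
Proof.
move=> uB; rewrite /invmx uB -scalemxAr mxE mulrC; congr (_ / _).
rewrite (expand_det_row _ k) mxE; apply: eq_bigr => j _.
rewrite !mxE eqxx; congr (_ * (_ * \det _)).
by apply/matrixP=> i l; rewrite !mxE eq_sym (negPf (neq_lift _ _)) mxE.
Qed.

Variables (gT : finGroupType) (G : {group gT}).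

(* Among the full-rank families of rows of matrices in the image of rG, one   *)
(* whose determinant divides all the others spans an invariant lattice.       *)
Lemma integral_form n (rG : mx_representation algC G n) :
  exists2 B, B \in unitmx
    & {in G, forall (x : gT) i j, (B *m rG x *m invmx B) i j \in local_ring}.
Proof.
pose M (s : {ffun 'I_n -> gT * 'I_n}) := \matrix_i row (s i).2 (rG (s i).1).
pose S := [set s : {ffun 'I_n -> gT * 'I_n} | [forall i, (s i).1 \in G]].
have [|d /mapP[s]] := @local_max [seq \det (M s) | s <- enum S].
  apply/hasP; exists 1; last exact: oner_neq0.
  apply/mapP; exists [ffun i => (1%g, i)].
    by rewrite mem_enum inE; apply/forallP=> i; rewrite ffunE group1.
  rewrite -(det1 algC n); congr (\det _).
  by apply/row_matrixP=> i; rewrite rowK ffunE repr_mx1.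
rewrite mem_enum inE => /forallP sG -> [nz_d max_d].
exists (M s) => [|x Gx i k]; first by rewrite unitmxE unitfE.
have -> (A : 'M[algC]_n) : A i k = (row i A) 0 k by rewrite mxE.
rewrite !row_mul cramer ?unitmxE ?unitfE //.
apply: max_d; apply/mapP.
(* By Cramer's rule the entry is a quotient of determinants. The numerator belongs to the same
   family: row k is replaced by a row of rG at ((s i).1 * x). *)
exists [ffun j => if j == k then ((s i).1 * x, (s i).2)%g else s j].
  rewrite mem_enum inE; apply/forallP=> j; rewrite ffunE.
  by case: ifP => // _; rewrite groupM.
congr (\det _); apply/row_matrixP=> j; rewrite !rowK ffunE.
by case: ifP => // _; rewrite /= repr_mxM ?row_mul.
Qed.

(** The integral form is reduced entrywise; identities over [algC] descend to the local ring because
    its inclusion is injective, and then pass to F. *)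
Lemma repr_reduction n (rG : mx_representation algC G n) :
  exists rF : mx_representation F G n,
    (forall (x : gT) xi, x \in G -> {subset xi <= Aint} ->
       char_poly (rG x) = \prod_(z <- xi) ('X - z%:P) ->
       char_poly (rF x) = \prod_(z <- xi) ('X - (red z)%:P))
    /\ forall L : {set gT}, L \subset G ->
       \sum_(x in L) rG x = 0 -> \sum_(x in L) rF x = 0.
Proof.
have [B uB B_loc] := integral_form rG.
pose C (x : gT) : 'M[O]_n := \matrix_(i, j) insubd (0 : O) ((B *m rG x *m invmx B) i j).
have CE (x : gT) : x \in G -> map_mx local_incl (C x) = B *m rG x *m invmx B.
  move=> Gx; apply/matrixP=> i j; rewrite [LHS]mxE local_inclE [C x i j]mxE.
  by rewrite val_insubd B_loc.
have incl_inj (X Y : 'M[O]_n) : map_mx local_incl X = map_mx local_incl Y -> X = Y.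
  move=> eqXY; apply/matrixP=> i j; apply: local_incl_inj.
  by have /matrixP/(_ i j) := eqXY; rewrite !mxE.
have rP : mx_repr G (fun x : gT => map_mx residue (C x)).
  split=> [|x y Gx Gy].
    rewrite -(map_mx1 residue); congr map_mx; apply: incl_inj.
    by rewrite CE // repr_mx1 mulmx1 mulmxV // map_mx1.
  rewrite -map_mxM; congr map_mx; apply: incl_inj.
  rewrite map_mxM !CE ?groupM // repr_mxM // !mulmxA.
  by rewrite -(mulmxA _ (invmx B) B) mulVmx // mulmx1.
exists (MxRepresentation rP); split=> [x xi Gx Axi Dxi | L sLG sumL0] /=.
  pose xiO := [seq insubd (0 : O) z | z <- xi].
  have xiE : [seq local_incl z | z <- xiO] = xi.
    rewrite -map_comp -[RHS]map_id; apply/eq_in_map => z /Axi Az /=.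
    by rewrite local_inclE val_insubd Aint_local.
  have DxiO : char_poly (C x) = \prod_(z <- xiO) ('X - z%:P).
    apply: (map_inj_poly local_incl_inj); rewrite ?rmorph0 // map_char_poly CE //.
    rewrite rmorph_prod /=.
    under eq_bigr do rewrite map_polyXsubC.
    by rewrite char_poly_conj // Dxi -[in LHS]xiE big_map.
  rewrite -map_char_poly DxiO rmorph_prod /= big_map.
  apply: eq_big_seq => z /Axi Az; rewrite map_polyXsubC /=.
  by rewrite residue_Aint ?val_insubd ?Aint_local.
rewrite -map_mx_sum -[LHS]/(map_mx residue _) -(map_mx0 residue); congr map_mx.
apply: incl_inj; rewrite map_mx_sum map_mx0.
under eq_bigr => x /(subsetP sLG) Gx do rewrite CE //.
by rewrite -mulmx_suml -mulmx_sumr sumL0 mulmx0 mul0mx.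
Qed.

End Localization.

(** In the basis formed by the rows of V and W, the matrix A is block lower triangular. *)
Lemma char_poly_block (K : fieldType) r m n (e : (r + m = n)%N)
    (A : 'M[K]_n) (A1 : 'M_r) (A2 : 'M_m) (X : 'M_(m, r)) V W :
    V *m A = A1 *m V -> W *m A = X *m V + A2 *m W -> row_full (col_mx V W) ->
  char_poly A = char_poly A1 * char_poly A2.
Proof.
subst n => VA WA; set B := col_mx V W => fullB.
have uB : B \in unitmx by rewrite -row_full_unit.
have BA : B *m A = block_mx A1 0 X A2 *m B.
  by rewrite mul_col_mx mul_block_col mul0mx addr0 VA WA.
rewrite -(char_poly_conj A uB) BA mulmxK //.
rewrite /char_poly /char_poly_mx map_block_mx scalar_mx_block.
by rewrite opp_block_mx add_block_mx map_mx0 subr0 det_lblock.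
Qed.

(** * Submodules and quotients *)

Section CompositionFactors.

Variables (K : fieldType) (gT : finGroupType) (G : {group gT}) (n : nat).
Variables (rG : mx_representation K G n) (U : 'M[K]_n) (modU : mxmodule rG U).

Lemma char_poly_sub_fact x : x \in G ->
  char_poly (rG x) = char_poly (submod_mx modU x) * char_poly (factmod_mx modU x).
Proof.
move=> Gx; pose V := val_submod (1%:M : 'M_(\rank U)).
pose W := val_factmod (1%:M : 'M_(\rank (cokermx U))).
have e : (\rank U + \rank (cokermx U) = n)%N by rewrite mxrank_coker subnKC ?rank_leq_row.
apply: (char_poly_block e (X := in_submod U (W *m rG x)) (V := V) (W := W)).
- by rewrite -val_submodJ // mul1mx val_submodE.
- rewrite -[LHS](add_sub_fact_mod U) val_submodE; congr (_ + _).
  by rewrite val_factmodE.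
rewrite -sub1mx -addsmxE -{1}(add_sub_fact_mod U 1%:M) addmx_sub_adds //.
  by rewrite val_submodE submxMl.
by rewrite val_factmodE submxMl.
Qed.

Lemma sum_submod0 (L : {set gT}) :
  \sum_(x in L) rG x = 0 -> \sum_(x in L) submod_mx modU x = 0.
Proof.
by rewrite /submod_mx -linear_sum -mulmx_sumr => ->; rewrite mulmx0 linear0.
Qed.

Lemma sum_factmod0 (L : {set gT}) :
  \sum_(x in L) rG x = 0 -> \sum_(x in L) factmod_mx modU x = 0.
Proof.
by rewrite /factmod_mx -linear_sum -mulmx_sumr => ->; rewrite mulmx0 linear0.
Qed.

End CompositionFactors.

(** A rank factorization E = C R satisfies R C = c I, so the trace of E is c times its rank. *)
Lemma mxtrace_idempotent_eq0 n (E : 'M[algC]_n) c :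
  c != 0 -> E *m E = c *: E -> \tr E = 0 -> E = 0.
Proof.
move=> nz_c EE trE0; apply/eqP; rewrite -mxrank_eq0.
move: (row_base_free E) (col_base_full E) (mulmx_base E).
move: (row_base E) (col_base E) => R C freeR fullC CR.
have RC : R *m C = c%:M.
  apply: (row_free_inj freeR); apply: (row_full_inj fullC) => /=.
  rewrite !mulmxA CR -mulmxA CR EE.
  by rewrite mul_mx_scalar -scalemxAl CR.
rewrite -(pnatr_eq0 algC); apply/eqP/(mulfI nz_c).
by rewrite mulr0 mulr_natr -mxtrace_scalar -RC mxtrace_mulC CR.
Qed.

(** * Brauer characters and the trivial decomposition number *)

Section BrauerCharacters.

Variables (p : nat) (F : fieldType) (red : algC -> F).
Hypothesis redP : modular_reduction p red.

Let pF : p \in [pchar F]. Proof. by case: redP. Qed.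
Let red_1 : red 1 = 1. Proof. by case: redP. Qed.
Let redM : {in Aint &, {morph red : x y / x * y}}. Proof. by case: redP. Qed.

Definition p'root (z : algC) := exists2 k, ~~ (p %| k)%N & z ^+ k = 1.

Lemma p'root_Aint z : p'root z -> z \in Aint.
Proof.
case=> [[|k]]; first by rewrite dvdn0.
by move=> _ zk1; apply: (@Aint_unity_root k.+1) => //; apply/unity_rootP.
Qed.

(** If u = z / w differs from 1 and u^N = 1 with N prime to p, then the sum of u^i over i < N is 0;
    but if u reduces to 1, that sum reduces to N, which is nonzero in F. *)
Lemma red_p'root_inj z w : p'root z -> p'root w -> red z = red w -> z = w.
Proof.
move=> rz rw; have [[k p'k zk1] [l p'l wl1]] := (rz, rw).
have nz_l : l != 0%N by apply: contraNneq p'l => ->; rewrite dvdn0.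
have nz_w : w != 0.
  apply/eqP=> w0; move/eqP: wl1.
  by rewrite w0 expr0n (negPf nz_l) eq_sym oner_eq0.
pose u := z / w; pose N := (k * l)%N.
have uN1 : u ^+ N = 1.
  by rewrite expr_div_n {1}exprM zk1 expr1n /N mulnC exprM wl1 expr1n divr1.
have p'N : ~~ (p %| N)%N by rewrite Euclid_dvdM ?(pcharf_prime pF) // negb_or p'k.
have ru : p'root u by exists N.
move=> eq_red; have redu1 : red u = 1.
  have nz_rw : red w != 0.
    apply/eqP=> rw0; have := redX redP l (p'root_Aint rw).
    rewrite wl1 rw0 red_1 expr0n (negPf nz_l).
    by move/eqP; rewrite oner_eq0.
  apply: (mulIf nz_rw); rewrite -redM ?p'root_Aint // divfK //.
  by rewrite mul1r.
suff u1 : u = 1 by rewrite -[z](divfK nz_w) -/u u1 mul1r.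
apply/eqP; rewrite -subr_eq0; apply: contraNT p'N => nz_u1.
have : \sum_(i < N) u ^+ i = 0.
  by apply: (mulfI nz_u1); rewrite -subrX1 uN1 subrr mulr0.
move/(congr1 red); rewrite (red_sum redP) => [|i _]; last first.
  by rewrite rpredX ?p'root_Aint.
rewrite (red0 redP); under eq_bigr do rewrite (redX redP) ?p'root_Aint // redu1 expr1n.
by rewrite sumr_const card_ord => /eqP; rewrite (dvdn_pcharf pF).
Qed.

Definition splits_over (P : {poly F}) (xi : seq algC) :=
  {in xi, forall z, p'root z} /\ P = \prod_(z <- xi) ('X - (red z)%:P).

Definition lift (a : F) : algC :=
  if pselect (exists2 z, p'root z & red z = a) is left ex_z
  then projT1 (cid2 ex_z) else 0.

Lemma liftK z : p'root z -> lift (red z) = z.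
Proof.
move=> rz; rewrite /lift; case: pselect => [ex_z | []]; last by exists z.
by case: (cid2 ex_z) => w rw /= /red_p'root_inj->.
Qed.

(** The Brauer character value as a function of the characteristic polynomial, with default 0 if the
    roots do not all lift to p'-roots of unity. It is independent of the chosen xi because lifts are
    unique. *)
Definition lift_sum (P : {poly F}) : algC :=
  if pselect (exists xi, splits_over P xi) is left ex_xi
  then \sum_(z <- projT1 (cid ex_xi)) z else 0.

Lemma lift_sumE P xi : splits_over P xi -> lift_sum P = \sum_(z <- xi) z.
Proof.
move=> Pxi; rewrite /lift_sum; case: pselect => [ex_xi | []]; last by exists xi.
case: (cid ex_xi) Pxi => eta /= [reta ->] [rxi].
rewrite -!(big_map red predT (fun a => 'X - a%:P)) => /prod_XsubC_eq eq_red.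
have lift_map s : {in s, forall z, p'root z} -> \sum_(z <- s) z = \sum_(a <- map red s) lift a.
  by move=> rs; rewrite big_map; apply: eq_big_seq => z /rs/liftK->.
by rewrite !lift_map // (perm_big _ eq_red).
Qed.

Lemma splits_overM P Q xi : P \is monic -> Q \is monic -> splits_over (P * Q) xi ->
  exists xi1 xi2, [/\ splits_over P xi1, splits_over Q xi2 & perm_eq xi (xi1 ++ xi2)].
Proof.
elim: xi P Q => [|z xi IHxi] P Q mP mQ [rxi].
  rewrite big_nil => PQ1.
  have one R : R \is monic -> R %| 1 -> R = 1 :> {poly F}.
    by move=> mR; rewrite dvdp1 size_poly_eq1 eqp_monic ?monic1 // => /eqP.
  exists [::], [::]; split=> //; split=> //; rewrite big_nil.
    by apply: one; rewrite // -PQ1 dvdp_mulr.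
  by apply: one; rewrite // -PQ1 dvdp_mull.
have rxi' : {in xi, forall z, p'root z} by move=> w w_xi; apply: rxi; rewrite inE w_xi orbT.
have rz : p'root z by apply: rxi; rewrite mem_head.
rewrite big_cons => DPQ; set a := red z in DPQ.
have nzX : 'X - a%:P != 0 by rewrite polyXsubC_eq0.
have : root (P * Q) a by rewrite DPQ rootM root_XsubC eqxx.
have splits_cons R eta : splits_over R eta -> splits_over (R * ('X - a%:P)) (z :: eta).
  case=> reta ->; split; last by rewrite big_cons mulrC.
  by move=> w; rewrite inE => /predU1P[-> | /reta].
rewrite rootM => /orP[] /factor_theorem[R DR].
  have mR : R \is monic by rewrite -(monicMr _ (monicXsubC a)) -DR.
  have [|xi1 [xi2 [s1 s2 eq_xi]]] := IHxi R Q mR mQ.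
    by split=> //; apply: (mulfI nzX); rewrite -DPQ DR mulrA [_ * R]mulrC.
  exists (z :: xi1), xi2; rewrite DR /= perm_cons; split=> //.
  exact: splits_cons.
have mR : R \is monic by rewrite -(monicMr _ (monicXsubC a)) -DR.
have [|xi1 [xi2 [s1 s2 eq_xi]]] := IHxi P R mP mR.
  by split=> //; apply: (mulfI nzX); rewrite -DPQ DR [LHS]mulrC mulrA.
exists xi1, (z :: xi2); rewrite DR; split=> //; first exact: splits_cons.
by rewrite perm_sym -cat1s perm_catCA /= perm_cons perm_sym.
Qed.

Section Representation.

Variables (gT : finGroupType) (G L : {group gT}).
Hypotheses (sLG : L \subset G) (p'L : (p^').-group L).

Let pregJ x y : y \in G -> (x ^ y \in preg p G)%g = (x \in preg p G).
Proof. by move=> Gy; rewrite memJ_norm // (subsetP (normal_norm (preg_normal p G))). Qed.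

Let char_poly_reprJ n (rG : mx_representation F G n) x y : x \in G -> y \in G ->
  char_poly (rG (x ^ y)%g) = char_poly (rG x).
Proof.
move=> Gx Gy; rewrite conjgE !repr_mxM ?groupM ?groupV // mulmxA.
have -> : rG y = invmx (rG y^-1%g) by rewrite -repr_mxV ?groupV ?invgK.
by rewrite char_poly_conj ?repr_mx_unit ?groupV.
Qed.

Definition brauer_fun n (rG : mx_representation F G n) (x : gT) :=
  lift_sum (char_poly (rG x)) *+ (x \in preg p G).

Fact brauer_char_subproof n (rG : mx_representation F G n) :
  is_class_fun <<G>> [ffun x => brauer_fun rG x].
Proof.
rewrite genGid; apply: intro_class_fun => [x y Gx Gy | x G'x].
  by rewrite /brauer_fun (pregJ x Gy) (char_poly_reprJ rG Gx Gy).
by rewrite /brauer_fun inE (negPf G'x).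
Qed.
Definition brauer_char n rG := Cfun 0 (@brauer_char_subproof n rG).

(** Holds for reductions of representations over [algC], and passes to submodules and quotients. *)
Definition splittable n (rG : mx_representation F G n) :=
  {in preg p G, forall x, exists xi, splits_over (char_poly (rG x)) xi}.

Lemma brauer_charE n (rG : mx_representation F G n) x xi :
  x \in preg p G -> splits_over (char_poly (rG x)) xi ->
  brauer_char rG x = \sum_(z <- xi) z.
Proof. by move=> px /lift_sumE; rewrite cfunE /brauer_fun px => ->. Qed.

Lemma brauer_charP n (rG : mx_representation F G n) :
  splittable rG -> affords_brauer p red rG (brauer_char rG).
Proof.
move=> split_rG; split.
  by apply/cfun_onP=> x /negPf p'x; rewrite cfunE /brauer_fun p'x.
move=> x px; have [xi rG_xi] := split_rG x px; exists xi.
by split; rewrite ?(brauer_charE px rG_xi) //; case: rG_xi.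
Qed.

Lemma splits_sub_fact n (rG : mx_representation F G n) U (modU : mxmodule rG U) x :
  splittable rG -> x \in preg p G -> exists xi1 xi2,
  [/\ splits_over (char_poly (submod_repr modU x)) xi1,
      splits_over (char_poly (factmod_repr modU x)) xi2
    & brauer_char rG x = \sum_(z <- xi1 ++ xi2) z].
Proof.
move=> split_rG px; have [xi rG_xi] := split_rG x px.
have := rG_xi; rewrite (char_poly_sub_fact modU); last by case/setIdP: px.
case/splits_overM; rewrite ?char_poly_monic // => xi1 [xi2 [s1 s2 eq_xi]].
exists xi1, xi2; split=> //.
by rewrite (brauer_charE px rG_xi); apply: perm_big.
Qed.

Lemma splittable_sub n (rG : mx_representation F G n) U (modU : mxmodule rG U) :
  splittable rG -> splittable (submod_repr modU).
Proof.
by move=> split_rG x /(splits_sub_fact modU split_rG)[xi1 [_ [s1 _ _]]]; exists xi1.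
Qed.

Lemma splittable_fact n (rG : mx_representation F G n) U (modU : mxmodule rG U) :
  splittable rG -> splittable (factmod_repr modU).
Proof.
by move=> split_rG x /(splits_sub_fact modU split_rG)[_ [xi2 [_ s2 _]]]; exists xi2.
Qed.

Lemma brauer_char_sub_fact n (rG : mx_representation F G n) U (modU : mxmodule rG U) :
  splittable rG ->
  brauer_char rG = brauer_char (submod_repr modU) + brauer_char (factmod_repr modU).
Proof.
move=> split_rG; apply/cfunP=> x; rewrite [RHS]cfunE.
have [px | p'x] := boolP (x \in preg p G); last first.
  by rewrite !cfunE /brauer_fun (negPf p'x) addr0.
have [xi1 [xi2 [s1 s2 ->]]] := splits_sub_fact modU split_rG px.
by rewrite (brauer_charE px s1) (brauer_charE px s2) big_cat.
Qed.

(** Induction on the degree: both hypotheses pass to a proper nonzero submodule and to its quotient,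
    and Brauer characters add up. *)
Lemma composition_factors n (rG : mx_representation F G n) :
    splittable rG -> \sum_(x in L) rG x = 0 ->
  exists2 s, brauer_char rG = \sum_(psi <- s) psi
    & {in s, forall psi, exists m (rV : mx_representation F G m),
        [/\ mx_irreducible rV, splittable rV,
            psi = brauer_char rV & \sum_(x in L) rV x = 0]}.
Proof.
have [N] := ubnP n; elim: N n rG => // N IHN n rG /ltnSE-le_nN split_rG kill_rG.
have [n0 | n_gt0] := posnP n.
  exists [::] => //; rewrite big_nil; apply/cfunP=> x; rewrite [RHS]cfunE.
  have [px | p'x] := boolP (x \in preg p G); last by rewrite cfunE /brauer_fun (negPf p'x).
  rewrite (brauer_charE (xi := [::]) px) ?big_nil //; split=> //.
  rewrite big_nil; move: (rG x); rewrite n0 => A.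
  by rewrite /char_poly det_mx00.
case: (pselect (mx_irreducible rG)) => [irrG | redG].
  exists [:: brauer_char rG]; first by rewrite big_seq1.
  by move=> psi; rewrite inE => /eqP->; exists n, rG.
have [U [modU nzU not_fullU]] : exists U : 'M_n, [/\ mxmodule rG U, U != 0 & ~~ row_full U].
  apply: contrapT => noU; apply/redG/mx_irrP; split=> // U modU nzU.
  by apply: contrapT => /negP not_full; apply: noU; exists U.
have rankU : (\rank U < n)%N by rewrite ltn_neqAle rank_leq_col andbT.
have rankU_gt0 : (0 < \rank U)%N by rewrite lt0n mxrank_eq0.
have [||s1 D1 s1P] := IHN _ (submod_repr modU) (leq_trans rankU le_nN).
- exact: splittable_sub.
- exact: sum_submod0.
have [|||s2 D2 s2P] := IHN _ (factmod_repr modU).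
- by rewrite mxrank_coker (leq_trans _ le_nN) // ltn_subrL rankU_gt0.
- exact: splittable_fact.
- exact: sum_factmod0.
exists (s1 ++ s2); first by rewrite (brauer_char_sub_fact modU) // D1 D2 big_cat.
by move=> psi; rewrite mem_cat => /orP[/s1P | /s2P].
Qed.

(** The value at 1 forces degree 1. The p'-group L consists of p-regular elements, on which the only
    eigenvalue lifts to 1; so L acts trivially and the sum is #|L|, nonzero in F. *)
Lemma trivial_brauer_fixes n (rV : mx_representation F G n) :
  splittable rV -> brauer_char rV = trivial_brauer p G ->
  \sum_(x in L) rV x != 0.
Proof.
move=> split_rV DrV.
have p1 : 1%g \in preg p G by rewrite !inE group1 p_elt1.
have rV1 x xi : x \in preg p G -> splits_over (char_poly (rV x)) xi -> \sum_(z <- xi) z = 1.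
  move=> px /(brauer_charE px) <-; rewrite DrV cfpregE px cfun1E.
  by case/setIdP: px => ->.
have n1 : n = 1%N.
  pose xi := nseq n (1 : algC).
  have s_xi : splits_over (char_poly (rV 1%g)) xi.
    split=> [z | ]; first by rewrite mem_nseq => /andP[_ /eqP->]; exists 1%N; rewrite ?expr1n // dvdn1 neq_ltn prime_gt1 ?orbT // (pcharf_prime pF).
    rewrite repr_mx1 /xi big_nseq red_1 char_poly_trig ?scalar_mx_is_trig //.
    under eq_bigr do rewrite mxE eqxx.
    by rewrite prodr_const card_ord -Monoid.iteropE.
  have := rV1 _ _ p1 s_xi; rewrite big_nseq -Monoid.iteropE -/(_ *+ n) => /eqP.
  by rewrite pnatr_eq1 => /eqP.
move: rV split_rV DrV rV1; rewrite n1 => rV split_rV _ rV1.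
have fixL x : x \in L -> rV x = 1.
  move=> Lx; have px : x \in preg p G.
    by rewrite inE (subsetP sLG) //= (mem_p_elt p'L).
  have [xi s_xi] := split_rV x px; have := rV1 _ _ px s_xi.
  have [rxi Dchar] := s_xi.
  have := congr1 (fun P : {poly F} => size P) Dchar.
  rewrite size_char_poly size_prod_XsubC.
  case: xi {s_xi rxi} Dchar => [|z [|//]] // + _; rewrite !big_seq1 => + z1.
  rewrite z1 red_1 /char_poly /char_poly_mx det_mx11 !mxE eqxx !mulr1n.
  move/addrI/oppr_inj/polyC_inj => rx1.
  by apply/matrixP=> i j; rewrite !ord1 mxE rx1.
rewrite (eq_bigr _ fixL) sumr_const; apply/eqP=> /matrixP/(_ 0 0).
rewrite mulmxnE !mxE eqxx => /eqP; rewrite -(dvdn_pcharf pF).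
move: p'L; rewrite /pgroup p'natE ?(pcharf_prime pF) // => /negPf->.
by [].
Qed.

Lemma decomposition_number_trivial0 (i : Iirr G) :
  \sum_(x in L) 'chi_i x = 0 ->
  decomposition_number p red 'chi_i (trivial_brauer p G) 0.
Proof.
move=> chiL0; pose rG := 'Chi_i; have DrG : cfRepr rG = 'chi_i by exact: irrRepr.
(* The sum E satisfies E^2 = #|L| E and has trace 0. *)
have killG : \sum_(x in L) rG x = 0.
  apply: (@mxtrace_idempotent_eq0 _ _ #|L|%:R); first by rewrite pnatr_eq0 -lt0n.
    rewrite {1}mulmx_suml scaler_nat -sumr_const; apply: eq_bigr => x Lx.
    rewrite mulmx_sumr [RHS](reindex_inj (mulgI x)) /=.
    apply: eq_big => y; first by rewrite groupMl.
    by move=> Ly; rewrite repr_mxM // (subsetP sLG).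
  rewrite -[RHS]chiL0 raddf_sum /=; apply: eq_bigr => x Lx.
  by rewrite -DrG cfunE (subsetP sLG).
have [rF [rF_char rF_kill]] := repr_reduction redP rG.
have splits x : x \in preg p G -> exists2 xi, splits_over (char_poly (rF x)) xi & 'chi_i x = \sum_(z <- xi) z.
  case/setIdP=> Gx px.
  have [e [[B uB Dx] [ex1 _] [chix _] _]] := repr_rsim_diag rG Gx.
  pose xi := [seq e 0 j | j : 'I__].
  have rxi z : z \in xi -> p'root z.
    case/mapP=> j _ ->; exists #[x]%g; last exact: ex1.
    by move: px; rewrite /p_elt p'natE ?(pcharf_prime pF).
  exists xi; last by rewrite -DrG chix big_image.
  split=> //; apply: rF_char => // [z /rxi/p'root_Aint // |].
  rewrite Dx -[X in _ *m X]invmxK char_poly_conj ?unitmx_inv //.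
  rewrite char_poly_trig ?diag_mx_is_trig // big_image.
  by apply: eq_bigr => j _; rewrite mxE eqxx.
have split_rF : splittable rF by move=> x /splits[xi]; exists xi.
have [s Ds sP] := composition_factors split_rF (rF_kill _ sLG killG).
exists s; split=> [psi /sP[m [rV [irrV split_V -> _]]] | |].
- by exists m, rV; split=> //; apply: brauer_charP.
- rewrite -Ds; apply/cfunP=> x; rewrite cfpregE.
  have [px | p'x] := boolP (x \in preg p G); last by rewrite cfunE /brauer_fun (negPf p'x).
  by have [xi s_xi ->] := splits x px; rewrite (brauer_charE px s_xi).
apply/eqP; rewrite -leqn0 leqNgt -has_count has_pred1.
apply/negP=> /sP[m [rV [_ split_V Dtriv killV]]].
by have := trivial_brauer_fixes split_V (esym Dtriv); rewrite killV eqxx.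
Qed.

End Representation.

End BrauerCharacters.

(** * Alternating sums of signed permutation characters *)

Section RestrictedSign.
Local Open Scope group_scope.

Variable T : finType.
Implicit Types (x z : T) (y g : {perm T}) (X Y B : {set T}).

Lemma stabP X y : reflect (forall x, (y x \in X) = (x \in X)) (y \in 'N(X | 'P)).
Proof. by apply: (iffP astabsP) => H x; have := H x; rewrite /= apermE. Qed.

Lemma restr_perm_eq X y s : y \in 'N(X | 'P) -> perm_on X s -> {in X, s =1 y} ->
  restr_perm X y = s.
Proof.
move=> nXy s_on s_y; apply/permP=> x; have [Xx | X'x] := boolP (x \in X).
  by rewrite restr_permE ?s_y.
by rewrite (out_perm (restr_perm_on X y)) ?(out_perm s_on).
Qed.

Lemma restr_perm_conj X y g : y \in 'N(g @: X | 'P) ->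
  restr_perm X (y ^ g^-1) = restr_perm (g @: X) y ^ g^-1.
Proof.
move=> nXy; have gX z : (g z \in g @: X) = (z \in X) by rewrite mem_imset //; apply: perm_inj.
have yE s x : (s ^ g^-1)%g x = g^-1%g (s (g x)) by rewrite conjgE invgK !permM.
have gVX z : (g^-1%g z \in X) = (z \in g @: X) by rewrite -gX permKV.
apply: restr_perm_eq.
- by apply/stabP=> x; rewrite yE gVX (stabP _ _ nXy) gX.
- apply/subsetP=> x; rewrite inE yE; apply: contraNT => X'x.
  rewrite (out_perm (restr_perm_on _ y)) ?gX // permK //.
by move=> x Xx; rewrite !yE restr_permE ?gX.
Qed.

Lemma restr_permU X Y y : [disjoint X & Y] -> y \in 'N(X | 'P) -> y \in 'N(Y | 'P) ->
  restr_perm (X :|: Y) y = restr_perm X y * restr_perm Y y.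
Proof.
move=> dXY nX nY; apply: restr_perm_eq.
- by apply/stabP=> x; rewrite !inE (stabP _ _ nX) (stabP _ _ nY).
- by apply: perm_onM; apply: subset_trans (restr_perm_on _ y) _; rewrite ?subsetUl ?subsetUr.
move=> x; rewrite permM !inE => /orP[Xx | Yx].
  rewrite (restr_permE nX Xx) (out_perm (restr_perm_on Y y)) //.
  by rewrite (disjointFr dXY) // (stabP _ _ nX).
rewrite (out_perm (restr_perm_on X y)) ?(restr_permE nY Yx) //.
by rewrite (disjointFl dXY).
Qed.

Lemma stab_porbit y z : y \in 'N(porbit y z | 'P).
Proof.
apply/stabP=> x; rewrite -!eq_porbit_mem.
by have := porbit_perm y 1 x; rewrite expg1 => ->.
Qed.

(** The cycles of the restriction are the orbit itself and one fixed point for each element outside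
    it. *)
Lemma odd_restr_porbit y z : odd_perm (restr_perm (porbit y z) y) = ~~ odd #|porbit y z|.
Proof.
set O := porbit y z; set r := restr_perm O y.
have nO : y \in 'N(O | 'P) := stab_porbit y z.
have rX i x : x \in O -> (r ^+ i)%g x = (y ^+ i)%g x /\ (y ^+ i)%g x \in O.
  move=> Ox; elim: i => [|i [IHi Oi]]; first by rewrite !expg0 !perm1.
  by rewrite !expgSr !permM IHi restr_permE // (stabP _ _ nO).
have porb_in : {in O, forall x, porbit r x = O}.
  move=> x Ox; apply/setP=> u; apply/porbitP/idP=> [[i ->] | Ou].
    by have [-> ] := rX i x Ox.
  have: u \in porbit y x by move: Ox Ou; rewrite /O -!eq_porbit_mem => /eqP->.
  by case/porbitP=> i ->; exists i; have [->] := rX i x Ox.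
have porb_out x : x \notin O -> porbit r x = [set x].
  move=> O'x; apply/setP=> u; rewrite inE; apply/porbitP/eqP=> [[i ->] | ->]; last by exists 0%N; rewrite perm1.
  elim: i => [|i IHi]; first by rewrite perm1.
  by rewrite expgSr permM IHi (out_perm (restr_perm_on O y)).
have Oz : z \in O := porbit_id y z.
have porbE : porbits r = O |: [set [set x] | x in ~: O].
  apply/setP=> U; rewrite !inE; apply/imsetP/idP=> [[x _ ->] | ].
    have [/porb_in-> | O'x] := boolP (x \in O); first by rewrite eqxx.
    by rewrite porb_out // imset_f ?orbT // inE.
  case/predU1P=> [-> | /imsetP[x O'x ->]]; first by exists z; rewrite ?porb_in.
  by exists x; rewrite // porb_out // -in_setC.
have -> : odd_perm r = odd #|T| (+) odd #|porbits r| by [].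
rewrite porbE cardsU1 card_imset; last exact: set1_inj.
have -> : O \notin [set [set x] | x in ~: O].
  apply/imsetP=> [[x O'x DO]]; move: O'x; rewrite inE DO set11 //.
by rewrite -(cardsC O) oddD add1n /= addbN -addbA addbb addbF.
Qed.

End RestrictedSign.

Lemma perm_of_coloring n (C : eqType) (c d : 'I_n -> C) :
  perm_eq [seq c x | x : 'I_n] [seq d x | x : 'I_n] ->
  exists g : 'S_n, forall x, d (g x) = c x.
Proof.
have E (f : 'I_n -> C) : [seq f x | x : 'I_n] = [tuple f x | x < n] by [].
rewrite !E => /tuple_permP[g Dg]; exists g => x.
have /(congr1 (fun t => tnth t x)) := val_inj Dg.
by rewrite !tnth_mktuple.
Qed.

Section SignedSubsets.

Variable n : nat.
Local Notation Sn := [set: 'S_n]%G.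
Implicit Types (X B : {set 'I_n}) (y g : 'S_n).

Definition rsign y X : algC := (-1) ^+ restr_perm X y.

Lemma rsignM X : {in 'N(X | 'P) &, {morph rsign^~ X : y g / (y * g)%g >-> y * g}}.
Proof. by move=> y g Ny Ng; rewrite /rsign morphM // odd_permM signr_addb. Qed.

(** A disjoint pair is a coloring with three colors, and colorings with the same color counts differ
    by a permutation. *)
Lemma trans_disjoint X0 B0 X B :
  [disjoint X0 & B0] -> [disjoint X & B] -> #|X| = #|X0| -> #|B| = #|B0| ->
  exists g : 'S_n, g @: X0 = X /\ g @: B0 = B.
Proof.
pose c (Y D : {set 'I_n}) (x : 'I_n) := if x \in Y then 0%N else if x \in D then 1%N else 2%N.
have c0 Y D x : (c Y D x == 0%N) = (x \in Y) by rewrite /c; do ?case: ifP.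
have c1 (Y D : {set 'I_n}) x : [disjoint Y & D] -> (c Y D x == 1%N) = (x \in D).
  move=> dYD; rewrite /c; case: ifPn => [Yx | _]; first by rewrite (disjointFr dYD).
  by case: ifP.
have cnt (Y D : {set 'I_n}) k : [disjoint Y & D] ->
    count_mem k [seq c Y D x | x : 'I_n] =
      if k == 0%N then #|Y| else if k == 1%N then #|D| else
      if k == 2%N then (n - (#|Y| + #|D|))%N else 0%N.
  move=> dYD; rewrite count_map -sum1_count big_enum_cond /= sum1_card.
  case: k => [|[|[|k]]] /=.
  - by rewrite -[LHS]cardsE; apply: eq_card => x; rewrite inE; apply: c0.
  - by rewrite -[LHS]cardsE; apply: eq_card => x; rewrite inE; apply: c1.
  - have -> : (#|Y| + #|D|)%N = #|Y :|: D|.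
      by rewrite cardsU (eqP (_ : Y :&: D == set0)) ?cards0 ?subn0 ?setI_eq0.
    have -> : (n - #|Y :|: D|)%N = #|~: (Y :|: D)| by rewrite [RHS]cardsCs setCK card_ord.
    rewrite -[LHS]cardsE; apply: eq_card => x.
    transitivity (c Y D x == 2%N); first by rewrite inE.
    by rewrite !inE /c; case: (x \in Y); case: (x \in D).
  rewrite -[LHS]cardsE; apply: eq_card0 => x.
  transitivity (c Y D x == k.+3); first by rewrite inE.
  by rewrite /c; case: (x \in Y); case: (x \in D).
move=> d0 d eqX eqB.
have [|g Dg] := @perm_of_coloring n nat (c X0 B0) (c X B).
  by apply/allP=> k _ /=; rewrite !cnt // eqX eqB.
exists g; split; apply/setP=> x; rewrite -[x](permKV g) mem_imset; try exact: perm_inj.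
  by rewrite -(c0 X0 B0) -(c0 X B) Dg.
by rewrite -(c1 _ _ _ d0) -(c1 _ _ _ d) Dg.
Qed.

Lemma mem_perm_imset g X x : (x \in g @: X) = (g^-1%g x \in X).
Proof. by rewrite -{1}[x](permKV g) mem_imset //; apply: perm_inj. Qed.

Lemma stab_imset X g g0 : ((g * g0^-1)%g \in 'N(X | 'P)) = (g @: X == g0 @: X).
Proof.
apply/stabP/eqP=> [H | eqX x].
  by apply/setP=> x; rewrite !mem_perm_imset -H permM permKV.
by rewrite permM -mem_perm_imset -eqX mem_imset //; apply: perm_inj.
Qed.

Lemma stab_conj X g y : ((y ^ g^-1)%g \in 'N(X | 'P)) = (y \in 'N(g @: X | 'P)).
Proof.
rewrite conjgE invgK mulgA stab_imset.
have := stab_imset (g @: X) y 1; rewrite invg1 mulg1 => ->.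
rewrite [(1%g : 'S_n) @: _](eq_imset (g := id)) => [|x]; last by rewrite perm1.
rewrite imset_id -imset_comp; congr (_ == _).
by apply: eq_imset => x /=; rewrite permM.
Qed.

Local Notation stab2 X B := ('N(X | 'P) :&: 'N(B | 'P))%G.

Fact rsign_repr X B : mx_repr (stab2 X B) (fun y => (rsign y X)%:M : 'M_1).
Proof.
split=> [|y g /setIP[Ny _] /setIP[Ng _]]; first by rewrite /rsign morph1 odd_perm1.
by rewrite rsignM // scalar_mxM.
Qed.

Definition rsign_char X B := cfRepr (MxRepresentation (rsign_repr X B)).

Definition sgn_ind X B : 'CF(Sn) := 'Ind[Sn] (rsign_char X B).

Lemma sgn_ind_char X B : sgn_ind X B \is a character.
Proof. by rewrite cfInd_char ?cfRepr_char. Qed.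

Definition invariant2 y (XB : {set 'I_n} * {set 'I_n}) :=
  [&& [disjoint XB.1 & XB.2], y \in 'N(XB.1 | 'P) & y \in 'N(XB.2 | 'P)].

(** Cosets of the stabilizer correspond to the images of (X0, B0), and only the pairs invariant
    under y contribute. *)
Lemma sgn_indE X0 B0 y : [disjoint X0 & B0] ->
  sgn_ind X0 B0 y = \sum_(XB : {set 'I_n} * {set 'I_n} | [&& #|XB.1| == #|X0|, #|XB.2| == #|B0|
                                   & invariant2 y XB]) rsign y XB.1.
Proof.
move=> dXB0; rewrite cfIndE ?subsetT //.
set H := stab2 X0 B0.
pose h g := (g @: X0, g @: B0).
pose P (XB : {set 'I_n} * {set 'I_n}) := [&& #|XB.1| == #|X0|, #|XB.2| == #|B0| & [disjoint XB.1 & XB.2 : {set 'I_n}]].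
rewrite (reindex_inj invg_inj) /= (partition_big h P) /=; last first.
  move=> g _; rewrite /P !card_imset ?eqxx; try exact: perm_inj.
  by rewrite -setI_eq0 -imsetI ?imset_eq0 ?setI_eq0 //; apply: in2W; apply: perm_inj.
have inner (XB : {set 'I_n} * {set 'I_n}) : P XB -> \sum_(g | h g == XB) rsign_char X0 B0 (y ^ g^-1)%g
                        = #|H|%:R * (rsign y XB.1 *+ invariant2 y XB).
  case: XB => X B /and3P[/= /eqP cX /eqP cB dXB].
  have [g0 [g0X g0B]] := trans_disjoint dXB0 dXB cX cB.
  have hE g : (h g == (X, B)) = (g \in H :* g0).
    by rewrite mem_rcoset inE !stab_imset g0X g0B.
  rewrite (eq_bigl _ _ hE) -(card_rcoset _ g0) mulr_natl -sumr_const.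
  apply: eq_bigr => g; rewrite -hE => /eqP[gX gB].
  rewrite cfunE inE !stab_conj gX gB /invariant2 dXB /=.
  case: (boolP (y \in 'N(X | 'P))) => //= nX; case: (boolP (y \in 'N(B | 'P))) => //= nB.
  by rewrite mxtrace_scalar /rsign -gX restr_perm_conj ?gX // odd_permJ.
rewrite mulr_sumr (eq_bigr (fun XB => rsign y XB.1 *+ invariant2 y XB)) => [|XB PXB].
  under eq_bigr do rewrite mulrb; rewrite -big_mkcondr; apply: eq_bigl => XB; rewrite /P -!andbA.
  by congr [&& _, _ & _]; rewrite /invariant2; case: [disjoint _ & _].
rewrite (eq_bigl (fun g => h g == XB)) => [|g]; last by rewrite /= !inE.
by rewrite inner // mulKf // pnatr_eq0 -lt0n.
Qed.

End SignedSubsets.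

Lemma sum_involution0 (I : finType) (P : pred I) (E : I -> algC) (t : I -> I) :
    involutive t -> (forall i, P i -> P (t i)) -> (forall i, P i -> E (t i) = - E i) ->
  \sum_(i | P i) E i = 0.
Proof.
move=> tK Pt Et; apply/eqP; rewrite -[_ == 0](mulrn_eq0 _ 2) mulr2n addr_eq0.
rewrite {1}(reindex_inj (inv_inj tK)) -sumrN; apply/eqP.
have PtE i : P (t i) = P i by apply/idP/idP=> [/Pt | /Pt //]; rewrite tK.
by apply: eq_big => // i; rewrite PtE => /Et.
Qed.

Section HookCharacter.

Variables (n Q : nat).
Hypotheses (Q_gt0 : (0 < Q)%N) (leQn : (Q <= n)%N).
Local Notation Sn := [set: 'S_n]%G.
Local Notation pairT := ({set 'I_n} * {set 'I_n})%type.
Implicit Types (X B : {set 'I_n}) (y g : 'S_n).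

Definition low (i : nat) : {set 'I_n} := [set x : 'I_n | (x < i)%N].

Lemma card_low i : (i <= n)%N -> #|low i| = i.
Proof.
move=> le_in; rewrite -sum1dep_card -(big_ord_widen_cond n xpredT (fun=> 1%N)) //.
by rewrite sum1_card card_ord.
Qed.

(** For i <= Q the stabilizer is the Young subgroup S_i x S_(Q-i) x S_(n-Q), and the induced
    character is sgn (x) 1 (x) 1. *)
Definition signed_perm_char i : 'CF(Sn) := sgn_ind (low i) (~: low Q).
Local Notation M := signed_perm_char.

Lemma signed_perm_char_char i : M i \is a character.
Proof. exact: sgn_ind_char. Qed.

Lemma signed_perm_charE i y : (i <= Q)%N ->
  M i y = \sum_(XB : pairT | [&& #|XB.1| == i, #|XB.2| == (n - Q)%N & invariant2 y XB])
            rsign y XB.1.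
Proof.
move=> leiQ; rewrite /M sgn_indE.
  by rewrite card_low ?(leq_trans leiQ) // cardsCs setCK card_ord card_low.
by rewrite -subsets_disjoint; apply/subsetP=> x; rewrite !inE => /leq_trans->.
Qed.

Let F y X : algC := (-1) ^+ #|X| * rsign y X.

(** Adding a cycle of length l multiplies (-1)^#|X| by (-1)^l and the sign on X by (-1)^(l-1). *)
Lemma signed_toggle y z X : y \in 'N(X | 'P) -> [disjoint X & porbit y z] ->
  F y (X :|: porbit y z) = - F y X.
Proof.
move=> nX dX; rewrite /F cardsU (eqP (_ : X :&: porbit y z == set0)) ?setI_eq0 //.
rewrite cards0 subn0 /rsign restr_permU ?stab_porbit // odd_permM odd_restr_porbit.
rewrite signr_addb exprD -[_ ^+ #|porbit y z|]signr_odd.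
by rewrite mulrACA -signr_addb addbN addbb mulrN1.
Qed.

(** Summed over all i, the terms cancel in pairs: toggle in X the y-orbit of a point z outside B.
    The choice of z depends on B alone, so toggling twice is the identity; z exists because #|B| = n
    - Q < n. *)
Lemma alternating_sum : \sum_(i < Q.+1) (-1) ^+ i *: M i = 0.
Proof.
apply/cfunP=> y; rewrite sum_cfunE cfunE.
pose P (XB : pairT) := (#|XB.2| == (n - Q)%N) && invariant2 y XB.
have card_X XB : P XB -> (#|XB.1| < Q.+1)%N.
  case: XB => X B /andP[/= /eqP cB /and3P[/= dXB _ _]].
  have : (#|X| <= #|~: B|)%N by rewrite subset_leq_card // -disjoints_subset.
  by rewrite [#|~: B|]cardsCs setCK card_ord cB subKn.
transitivity (\sum_(XB | P XB) F y XB.1).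
  rewrite (partition_big (fun XB : pairT => inord #|XB.1| : 'I_Q.+1) xpredT) //=.
  apply: eq_bigr => i _; rewrite cfunE signed_perm_charE -1?ltnS // mulr_sumr.
  apply: eq_big => [XB | XB /and3P[/eqP <- //]].
  apply/idP/idP=> [/and3P[/eqP ci cB iv] | /andP[PXB /eqP<-]].
    by rewrite /P cB iv /= ci inord_val.
  by rewrite inordK ?card_X // eqxx.
pose O B := if [pick z in ~: B] is Some z then porbit y z else set0.
pose t (XB : pairT) := ((XB.1 :\: O XB.2) :|: (O XB.2 :\: XB.1), XB.2).
apply: (sum_involution0 (t := t)).
- case=> X B; congr (_, _); apply/setP=> x; rewrite !inE /=.
  by case: (x \in X); case: (x \in O B).
- case=> X B /and4P[/= cB dXB nX nB].
  rewrite /P /= cB /invariant2 /= nB andbT; rewrite /O.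
  case: pickP => [z B'z | _]; last by rewrite setD0 set0D setU0 dXB.
  rewrite in_setC in B'z.
  have dzB : [disjoint porbit y z & B].
    apply/pred0P=> x /=; apply/negbTE; apply: contra B'z => /andP[/porbitP[i ->]].
    by rewrite (stabP _ _ (groupX i nB)).
  apply/andP; split.
    rewrite -setI_eq0 setIUl setU_eq0 !setI_eq0.
    by rewrite (disjointWl (subsetDl _ _) dXB) (disjointWl (subsetDl _ _) dzB).
  apply/stabP=> x; rewrite !inE (stabP _ _ nX).
  by rewrite (stabP _ _ (stab_porbit y z)).
case=> X B /and4P[/= cB dXB nX nB].
have B'0 : exists z, z \in ~: B.
  apply/set0Pn; rewrite -card_gt0 cardsCs setCK card_ord (eqP cB) subKn //.
rewrite /O; case: pickP => [z _ | no_z]; last by case: B'0 => z; rewrite no_z.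
have [Xz | X'z] := boolP (z \in X).
  have sOX : porbit y z \subset X.
    by apply/subsetP=> _ /porbitP[i ->]; rewrite (stabP _ _ (groupX i nX)).
  have -> : porbit y z :\: X = set0 by apply/eqP; rewrite setD_eq0.
  rewrite setU0 -{2}[X](setID _ (porbit y z)) setUC (setIidPr sOX).
  rewrite signed_toggle ?opprK //.
    by apply: (subsetP (astabsD _ _ _)); rewrite inE nX stab_porbit.
  by rewrite -setI_eq0 setIDAC setDIl setDv setI0.
have dXO : [disjoint X & porbit y z].
  apply/pred0P=> x /=; apply/negbTE; apply: contra X'z => /andP[Xx /porbitP[i Dx]].
  by rewrite Dx (stabP _ _ (groupX i nX)) in Xx.
have [-> ->] : X :\: porbit y z = X /\ porbit y z :\: X = porbit y z.
  by split; apply/setDidPl; rewrite // disjoint_sym.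
exact: signed_toggle.
Qed.

(** For k < Q this is (-1)^k times the character induced from S_Q x S_(n-Q) of the hook character
    (Q-k, 1^k) times the trivial character. *)
Definition hook_char k : 'CF(Sn) := \sum_(i < k.+1) (-1) ^+ i *: M i.
Local Notation Theta := hook_char.

Lemma hook_char_vchar k : Theta k \in 'Z[irr Sn].
Proof.
apply: rpred_sum => i _; rewrite rpredZsign.
exact/char_vchar/signed_perm_char_char.
Qed.

Lemma alternating_binomials k :
  \sum_(i < k.+1) (-1) ^+ i * 'C(Q, i)%:R = (-1) ^+ k * 'C(Q.-1, k)%:R :> algC.
Proof.
elim: k => [|k IHk]; first by rewrite big_ord1 !bin0.
rewrite big_ord_recr IHk /= -[in 'C(Q, _)](prednK Q_gt0) binS natrD.
by rewrite exprS mulN1r !mulNr mulrDr opprD addrCA subrr addr0.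
Qed.

Lemma hook_char1 k : (k < Q)%N ->
  Theta k 1%g = (-1) ^+ k * ('C(Q.-1, k) * 'C(n, Q))%:R.
Proof.
move=> ltkQ; rewrite natrM mulrA -alternating_binomials mulr_suml sum_cfunE.
apply: eq_bigr => i _; rewrite cfunE signed_perm_charE; last first.
  exact: leq_trans (ltnW (ltn_ord i)) ltkQ.
rewrite -mulrA; congr (_ * _).
rewrite (eq_bigr (fun=> 1)) => [|XB _]; last by rewrite /rsign morph1 odd_perm1.
rewrite (eq_bigl (fun XB : pairT => (#|XB.2| == n - Q)%N
                    && ((XB.1 \subset ~: XB.2) && (#|XB.1| == i)))) => [|XB]; last first.
  by rewrite /invariant2 !group1 !andbT -disjoints_subset andbCA [_ && (_ == i :> nat)]andbC.
rewrite -(natr_sum _ _ _ (fun=> 1%N)) -natrM; congr _%:R.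
rewrite (reindex (fun BX : pairT => (BX.2, BX.1))) /=; last first.
  by exists (fun BX : pairT => (BX.2, BX.1)) => - [].
rewrite -(pair_big_dep (fun B : {set 'I_n} => #|B| == n - Q)%N
            (fun B X : {set 'I_n} => (X \subset ~: B) && (#|X| == i)) (fun _ _ => 1%N)) /=.
rewrite (eq_bigr (fun=> 'C(Q, i))) => [|B /eqP cB]; last first.
  rewrite sum1dep_card cards_draws; congr 'C(_, i).
  by rewrite cardsCs setCK card_ord cB subKn.
rewrite sum_nat_const mulnC -(bin_sub leQn); congr (_ * _)%N.
have := card_draws 'I_n (n - Q)%N; rewrite card_ord => <-; apply: esym; exact: cardsE.
Qed.

(** Only B = ~: Z can contribute, so X lies in Z, where y1 and y2 coincide. *)
Lemma hook_char_eq k (Z : {set 'I_n}) y1 y2 : (k < Q)%N ->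
    y1 \in 'N(Z | 'P) -> y2 \in 'N(Z | 'P) -> {in Z, y1 =1 y2} ->
    (forall B, #|B| = (n - Q)%N ->
       (y1 \in 'N(B | 'P)) || (y2 \in 'N(B | 'P)) -> B = ~: Z) ->
  Theta k y1 = Theta k y2.
Proof.
move=> ltkQ nZ1 nZ2 eqZ uniqB.
rewrite !sum_cfunE; apply: eq_bigr => i _; rewrite !cfunE; congr (_ * _).
have leiQ : (i <= Q)%N := leq_trans (ltnW (ltn_ord i)) ltkQ.
have sub_inv y y' X B : #|B| = (n - Q)%N -> y \in 'N(Z | 'P) -> y' \in 'N(Z | 'P) ->
    {in Z, y =1 y'} -> (y \in 'N(B | 'P) -> B = ~: Z) -> invariant2 y (X, B) ->
  invariant2 y' (X, B) /\ rsign y X = rsign y' X.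
  move=> cB nZ nZ' eqyy' BZ /and3P[/= dXB nX nB].
  have sXZ : X \subset Z by rewrite -[Z]setCK -(BZ nB) -disjoints_subset.
  have nX' : y' \in 'N(X | 'P).
    apply/stabP=> x; have [Zx | Z'x] := boolP (x \in Z).
      by rewrite -eqyy' // (stabP _ _ nX).
    rewrite !(contraNF (subsetP sXZ _)) // (stabP _ _ nZ') //.
  split; first by rewrite /invariant2 /= dXB nX' (BZ nB) astabsC.
  congr (_ ^+ nat_of_bool (odd_perm _)); apply: restr_perm_eq => //.
    exact: restr_perm_on.
  by move=> x Xx; rewrite restr_permE // eqyy' // (subsetP sXZ).
rewrite !signed_perm_charE //; apply: eq_big => [[X B] | [X B] /and3P[_ /eqP cB iv]] /=.
  case: eqP => //= _; case: eqP => //= cB.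
  apply/idP/idP=> iv.
    have [] // := sub_inv y1 y2 X B cB nZ1 nZ2 eqZ _ iv.
    by move=> nB; apply: uniqB; rewrite ?nB.
  have eqZ' : {in Z, y2 =1 y1} by move=> x /eqZ.
  have [] // := sub_inv y2 y1 X B cB nZ2 nZ1 eqZ' _ iv.
  by move=> nB; apply: uniqB; rewrite ?nB ?orbT.
have [] // := sub_inv y1 y2 X B cB nZ1 nZ2 eqZ _ iv.
by move=> nB; apply: uniqB; rewrite ?nB.
Qed.

Section Vanishing.

Variable K : {group 'S_n}.

(** For a fixed pair (X, B), left multiplication by a transposition of K preserving X and B pairs
    the terms off with opposite signs. *)
Let swap_sum0 i (E : 'S_n -> algC) : (i <= Q)%N ->
    (forall X B, #|X| = i -> #|B| = (n - Q)%N -> [disjoint X & B] -> exists u v,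
       [/\ tperm u v \in K, tperm u v \in 'N(X | 'P), tperm u v \in 'N(B | 'P)
         & {in 'N(X | 'P), forall y, E (tperm u v * y)%g * rsign (tperm u v * y) X
                                     = - (E y * rsign y X)}]) ->
  \sum_(y in K) E y * M i y = 0.
Proof.
move=> leiQ swap.
under eq_bigr => y _ do rewrite signed_perm_charE // mulr_sumr.
rewrite (exchange_big_dep (fun XB : pairT => [&& #|XB.1| == i, #|XB.2| == (n - Q)%N & [disjoint XB.1 & XB.2]])) /=; last first.
  by move=> y XB _ /and3P[-> -> /and3P[-> _ _]].
rewrite big1 // => [[X B] /and3P[/= /eqP cX /eqP cB dXB]].
have [u [v [Kt nXt nBt Et]]] := swap X B cX cB dXB.
apply: (sum_involution0 (t := mulg (tperm u v))).
- by move=> y; rewrite mulgA tperm2 mul1g.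
- move=> y /andP[Ky]; rewrite cX cB !eqxx /= => /and3P[/= _ nX nB].
  by rewrite /invariant2 /= dXB !groupM.
by move=> y /and3P[_ _ /andP[_ /and3P[_ nX _]]]; rewrite Et.
Qed.

(** A transposition inside X changes the sign on X; so M i has no K-fixed vectors. *)
Lemma signed_perm_char_sum0 i : (i <= Q)%N ->
    (forall X, #|X| = i -> exists u v, [/\ u \in X, v \in X, u != v & tperm u v \in K]) ->
  \sum_(y in K) M i y = 0.
Proof.
move=> leiQ swap; transitivity (\sum_(y in K) 1 * M i y).
  by apply: eq_bigr => y _; rewrite mul1r.
apply: swap_sum0 => // X B cX cB dXB.
have [u [v [Xu Xv uv Kt]]] := swap X cX; exists u, v.
have nXt : tperm u v \in 'N(X | 'P).
  by apply/stabP=> x; case: tpermP => [-> | -> | //]; rewrite Xu Xv.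
split=> // [|y nXy].
  by apply/stabP=> x; case: tpermP => [-> | -> | //]; rewrite !(disjointFr dXB).
rewrite !mul1r rsignM //= {1}/rsign (restr_perm_eq (s := tperm u v)) ?odd_tperm ?uv ?mulN1r //.
by apply/subsetP=> x; rewrite inE; case: tpermP => [-> | -> | _ _ /eqP].
Qed.

(** A transposition outside X leaves the sign on X alone but changes the sign of y; so M i has no
    K-sign vectors. *)
Lemma signed_perm_char_sgn_sum0 i : (i <= Q)%N ->
    (forall X B, #|X| = i -> #|B| = (n - Q)%N -> [disjoint X & B] -> exists u v,
       [/\ u \notin X, v \notin X, (u \in B) = (v \in B), u != v & tperm u v \in K]) ->
  \sum_(y in K) (-1) ^+ y * M i y = 0.
Proof.
move=> leiQ swap; apply: swap_sum0 => // X B cX cB dXB.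
have [u [v [X'u X'v uvB uv Kt]]] := swap X B cX cB dXB; exists u, v.
have nXt : tperm u v \in 'N(X | 'P).
  by apply/stabP=> x; case: tpermP => [-> | -> | //]; rewrite (negPf X'u) (negPf X'v).
split=> // [|y nXy].
  by apply/stabP=> x; case: tpermP => [-> | -> | //]; rewrite uvB.
rewrite rsignM //= {1}/rsign (restr_perm_eq (s := 1)) ?perm_on1 ?odd_perm1 //; last first.
  move=> x Xx; rewrite perm1 tpermD //.
    by apply: contraNneq X'u => ->.
  by apply: contraNneq X'v => ->.
by rewrite mul1r odd_mul_tperm uv signr_addb mulN1r mulNr.
Qed.

End Vanishing.

End HookCharacter.

Lemma sum_char_ge0 (gT : finGroupType) (G K : {group gT}) (chi : 'CF(G)) :
  K \subset G -> chi \is a character -> 0 <= \sum_(x in K) chi x.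
Proof.
move=> sKG Nchi.
have -> : \sum_(x in K) chi x = #|K|%:R * '['Res[K] chi, 1].
  rewrite cfdotE mulVKf ?neq0CG //; apply: eq_bigr => x Kx.
  by rewrite cfResE // cfun1E Kx conjC1 mulr1.
rewrite mulr_ge0 ?ler0n ?natr_ge0 //.
by rewrite Cnat_cfdot_char ?cfRes_char ?cfun1_char.
Qed.

(** The sum of a character over K is #|K| times the multiplicity of 1_K, so nonnegative summands
    cannot cancel. *)
Lemma sum_constituent_eq0 (gT : finGroupType) (G K : {group gT}) (chi : 'CF(G)) i :
    K \subset G -> chi \is a character -> '[chi, 'chi_i] != 0 ->
  \sum_(x in K) chi x = 0 -> \sum_(x in K) 'chi_i x = 0.
Proof.
move=> sKG Nchi; rewrite -irr_consttE => /(constt_charP i Nchi)[psi Npsi ->].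
under eq_bigr do rewrite cfunE; rewrite big_split /=.
move/eqP; rewrite paddr_eq0 ?sum_char_ge0 ?irr_char //.
by case/andP=> /eqP.
Qed.

Section Constituents.

Variables (n Q k : nat) (K : {group 'S_n}).
Hypotheses (leQn : (Q <= n)%N) (ltkQ : (k < Q)%N).
Local Notation Sn := [set: 'S_n]%G.
Local Notation An := 'Alt_('I_n)%G.
Implicit Types (X B : {set 'I_n}) (y : 'S_n).

Fact sgn_repr : mx_repr Sn (fun y => ((-1) ^+ y)%:M : 'M[algC]_1).
Proof.
split=> [|y g _ _]; first by rewrite odd_perm1.
by rewrite odd_permM signr_addb scalar_mxM.
Qed.

Definition sgn_char := cfRepr (MxRepresentation sgn_repr).

Lemma sgn_charE y : sgn_char y = (-1) ^+ y.
Proof. by rewrite cfunE inE mxtrace_scalar. Qed.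

Hypothesis swap_in : forall X, (k < #|X|)%N ->
  exists u v, [/\ u \in X, v \in X, u != v & tperm u v \in K].
Hypothesis swap_out : forall X B, (#|X| <= k)%N -> #|B| = (n - Q)%N ->
  [disjoint X & B] -> exists u v, [/\ u \notin X, v \notin X,
    (u \in B) = (v \in B), u != v & tperm u v \in K].

Let Q_gt0 : (0 < Q)%N. Proof. exact: leq_ltn_trans ltkQ. Qed.

(* An irreducible psi with a K-fixed vector is orthogonal to all terms of     *)
(* index i > k, and one with a K-sign vector to all terms of index i <= k; in *)
(* either case the vanishing of the full alternating sum gives <theta, psi>=0. *)
Lemma hook_constituent_sums i : '[hook_char n Q k, 'chi_i] != 0 ->
  \sum_(y in K) 'chi_i y = 0 /\ \sum_(y in K) (-1) ^+ y * 'chi_i y = 0.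
Proof.
move=> nz_i; split.
  have [j /andP[lt_kj nz_j]] : exists j : 'I_Q.+1,
      (k < j)%N && ('[signed_perm_char n Q j, 'chi_i] != 0).
    apply/existsP; apply: contraNT nz_i => /existsPn no_j.
    have := alternating_sum Q_gt0 leQn.
    rewrite (bigID (fun j : 'I_Q.+1 => (j < k.+1)%N)) /=.
    have <- : hook_char n Q k = \sum_(j < Q.+1 | (j < k.+1)%N) (-1) ^+ j *: signed_perm_char n Q j.
      by apply: (big_ord_widen Q.+1 (fun j => (-1) ^+ j *: signed_perm_char n Q j)); apply: ltnW.
    move/(canRL (addrK _)) ->.
    rewrite sub0r cfdotNl oppr_eq0 cfdot_suml big1 // => j; rewrite -leqNgt => kj.
    rewrite cfdotZl; have := no_j j; rewrite kj negbK => /eqP->.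
    by rewrite mulr0.
  have le_jQ : (j <= Q)%N by rewrite -ltnS.
  apply: sum_constituent_eq0 nz_j _; rewrite ?subsetT ?signed_perm_char_char //.
  apply: signed_perm_char_sum0 => // X cX; apply: swap_in; rewrite cX //.
have [j nz_j] : exists j : 'I_k.+1, '[signed_perm_char n Q j, 'chi_i] != 0.
  apply/existsP; apply: contraNT nz_i => /existsPn no_j.
  rewrite cfdot_suml big1 // => j _; rewrite cfdotZl.
  by have := no_j j; rewrite negbK => /eqP->; rewrite mulr0.
have le_jQ : (j <= Q)%N := leq_trans (ltnW (ltn_ord j)) ltkQ.
have Mj := signed_perm_char_char n Q j.
have sum0 : \sum_(y in K) (-1) ^+ y * signed_perm_char n Q j y = 0.
  apply: signed_perm_char_sgn_sum0 => // X B cX; apply: swap_out.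
  by rewrite cX -ltnS.
move: nz_j sum0; rewrite -irr_consttE => /(constt_charP i Mj)[psi Npsi ->].
have tw (phi : 'CF(Sn)) y : (-1) ^+ y * phi y = (sgn_char * phi) y by rewrite cfunE sgn_charE.
under eq_bigr do rewrite tw mulrDr cfunE; rewrite big_split /=.
have ge0 (phi : 'CF(Sn)) : phi \is a character -> 0 <= \sum_(y in K) (sgn_char * phi) y.
  by move=> Nphi; rewrite sum_char_ge0 ?subsetT // rpredM ?cfRepr_char.
move/eqP; rewrite paddr_eq0 ?ge0 ?irr_char // => /andP[/eqP sum0 _].
rewrite -[RHS]sum0.
by apply: eq_bigr => y _; rewrite tw.
Qed.

(** Twice the sum over the even elements of K is the plain sum plus the signed sum over K, and both
    vanish for the constituents in S_n. *)
Lemma hook_Alt_constituent_sum i : '['Res[An] (hook_char n Q k), 'chi_i] != 0 ->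
  \sum_(y in K :&: An) 'chi_i y = 0.
Proof.
move=> nz_i.
have [j nz_j nz_ji] : exists2 j, '[hook_char n Q k, 'chi_j] != 0 & '['Res[An] 'chi_j, 'chi_i] != 0.
  suff /existsP[j /andP[]] : [exists j, ('[hook_char n Q k, 'chi_j] != 0)
                                     && ('['Res[An] 'chi_j, 'chi_i] != 0)] by exists j.
  apply: contraNT nz_i => /existsPn no_j.
  rewrite {1}[hook_char n Q k]cfun_sum_cfdot linear_sum cfdot_suml big1 // => j _.
  rewrite linearZ cfdotZl; apply/eqP; rewrite mulf_eq0.
  by have := no_j j; rewrite negb_and !negbK.
have [sum1 sum2] := hook_constituent_sums nz_j.
apply: sum_constituent_eq0 nz_ji _; rewrite ?subsetIr ?cfRes_char ?irr_char //.
transitivity (\sum_(y in K :&: An) 'chi_j y).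
  by apply: eq_bigr => y /setIP[_ Ay]; rewrite cfResE ?subsetT.
have : \sum_(y in K) ('chi_j y + (-1) ^+ y * 'chi_j y) = 0.
  by rewrite big_split /= sum1 sum2 addr0.
rewrite (bigID (@odd_perm 'I_n)) /= big1 ?add0r => [|y /andP[_ ->]]; last first.
  by rewrite mulN1r subrr.
move=> sum0; apply/eqP; rewrite -[_ == 0](mulrn_eq0 _ 2) -sumrMnl -[X in _ == X]sum0.
apply/eqP; apply: eq_big => [y | y /setIP[_]]; first by rewrite inE Alt_even.
by rewrite Alt_even => /negPf->; rewrite mul1r.
Qed.

End Constituents.

(** * The Young subgroup with blocks {4a, ..., 4a+3} *)

Section FourBlocks.
Local Open Scope nat_scope.

Variable n : nat.

Definition four_blocks : {set 'S_n} := [set y : 'S_n | [forall x : 'I_n, y x %/ 4 == x %/ 4]].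

Lemma four_blocksP (y : 'S_n) : reflect (forall x : 'I_n, y x %/ 4 = x %/ 4) (y \in four_blocks).
Proof. by rewrite inE; apply: (iffP forallP) => H x; apply/eqP. Qed.

Fact group_set_four_blocks : group_set four_blocks.
Proof.
apply/group_setP; split=> [|y z /four_blocksP yP /four_blocksP zP].
  by apply/four_blocksP=> x; rewrite perm1.
by apply/four_blocksP=> x; rewrite permM zP yP.
Qed.
Canonical four_blocks_group := Group group_set_four_blocks.

Lemma tperm_four_blocks (u v : 'I_n) : u %/ 4 = v %/ 4 -> tperm u v \in four_blocks.
Proof. by move=> uv; apply/four_blocksP=> x; case: tpermP => [-> | -> | ]. Qed.

(** An element of order p would have an orbit of length p > 4 inside one block. *)
Lemma p'group_four_blocks p : prime p -> (3 < p)%N -> p^'.-group four_blocks.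
Proof.
move=> pr_p p_gt3; rewrite /pgroup p'natE //; apply/negP=> /(Cauchy pr_p)[y Ky oy].
have ny1 : y != 1%g by rewrite -order_gt1 oy prime_gt1.
have [x nyx] : exists x, y x != x.
  apply/existsP; apply: contraNT ny1 => /existsPn fix_y.
  by apply/eqP/permP=> x; rewrite perm1; apply/eqP; have := fix_y x; rewrite negbK.
have O_dvd : (#|porbit y x| %| p)%N.
  by rewrite -oy porbit.unlock; apply: (dvdn_orbit 'P).
have O_p : #|porbit y x| = p.
  have /orP[|/eqP//] := (primeP pr_p).2 _ O_dvd.
  move/cards1P=> [z Dz]; case/negP: nyx.
  have := porbit_id y x; have := mem_porbit y 1 x.
  by rewrite Dz !inE expg1 => /eqP-> /eqP->.
have inj_mod : {in porbit y x &, injective (fun z : 'I_n => inord (z %% 4) : 'I_4)}.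
  have K_O z : z \in porbit y x -> z %/ 4 = x %/ 4.
    by case/porbitP=> i ->; apply/four_blocksP; rewrite groupX.
  move=> z w /K_O z4 /K_O w4 /(congr1 (@nat_of_ord 4)); rewrite !inordK ?ltn_mod // => zw.
  by apply: val_inj; rewrite /= (divn_eq z 4) (divn_eq w 4) z4 w4 zw.
have := card_in_imset inj_mod; rewrite O_p => Dp.
have := max_card (mem [set (inord ((z : 'I_n) %% 4) : 'I_4) | z in porbit y x]).
rewrite Dp card_ord => p_le4; move: pr_p p_gt3 p_le4; clear.
by case: p => [|[|[|[|[|]]]]].
Qed.

Lemma four_blocks_swap (A : {set 'I_n}) : ((n + 3) %/ 4 < #|A|)%N ->
  exists u v, [/\ u \in A, v \in A, u != v & tperm u v \in four_blocks].
Proof.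
(* The codomain has one value too many, [ord_max], so that [inord] is available; no block has that
   number, which keeps the count at n / 4 rounded up. *)
move=> ltPA; pose b (z : 'I_n) : 'I_((n + 3) %/ 4).+1 := inord (z %/ 4).
have bE (z : 'I_n) : b z = z %/ 4 :> nat /\ (z %/ 4 < (n + 3) %/ 4)%N.
  have lt_z : (z %/ 4 < (n + 3) %/ 4)%N.
    rewrite leq_divRL // mulSn addnC; apply: leq_trans (_ : z + 4 <= _)%N.
      by rewrite leq_add2r leq_divM.
    by rewrite -(addSnnS z 3) leq_add2r.
  by rewrite inordK // ltnS ltnW.
have [/dinjectiveP inj_b | ] := boolP (dinjectiveb b A).
  move: ltPA; rewrite -(card_in_imset inj_b) ltnNge => /negP[].
  apply: leq_trans (_ : #|[set~ ord_max]| <= _)%N.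
    apply: subset_leq_card; apply/subsetP=> _ /imsetP[z _ ->].
    by rewrite !inE -val_eqE /= (bE z).1 neq_ltn (bE z).2.
  by rewrite cardsC1 card_ord.
case/dinjectivePn=> u Au [v /andP[/= vu Av] buv]; exists u, v.
split=> //; first by rewrite eq_sym.
apply: tperm_four_blocks.
by rewrite -(bE u).1 buv (bE v).1.
Qed.

End FourBlocks.

(** * Binomial coefficients prime to p *)

Section BinomialsModP.
Local Open Scope nat_scope.

Variables (p j c : nat).
Hypotheses (pr_p : prime p) (c_gt0 : (0 < c)%N) (ltcp : (c < p)%N).
Local Notation q := (p ^ j)%N.
Local Notation Q := (c * q)%N.

Let logn_eq a b : (0 < a)%N -> (0 < b)%N ->
  (forall e, (p ^ e %| a)%N = (p ^ e %| b)%N) -> logn p a = logn p b.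
Proof.
move=> a0 b0 H; apply/eqP; rewrite eqn_leq; apply/andP; split.
  by rewrite -pfactor_dvdn // -H pfactor_dvdn.
by rewrite -pfactor_dvdn // H pfactor_dvdn.
Qed.

Let ndvd e a : (j < e)%N -> (0 < a)%N -> (a < p ^ j.+1)%N -> (p ^ e %| a)%N = false.
Proof.
move=> lt_je a0 lta; apply: gtnNdvd => //.
by apply: leq_trans lta _; rewrite leq_pexp2l ?prime_gt0.
Qed.

Let q_gt0 : (0 < q)%N. Proof. by rewrite expn_gt0 prime_gt0. Qed.

(** The powers p^e with e <= j divide Q, and larger ones exceed both i and Q - i because c < p. *)
Lemma logn_subQ i : (0 < i)%N -> (i < Q)%N -> logn p (Q - i) = logn p i.
Proof.
move=> i0 iQ; apply: logn_eq; rewrite ?subn_gt0 // => e.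
have ltQ : (Q < p ^ j.+1)%N by rewrite expnS ltn_mul2r q_gt0.
have [le_ej | lt_je] := leqP e j; last by rewrite !ndvd ?subn_gt0 //; lia.
have dQ : (p ^ e %| Q)%N by rewrite dvdn_mull // dvdn_exp2l.
by rewrite dvdn_subr // ltnW.
Qed.

Lemma logn_addQ i : (0 < i)%N -> (i < q)%N -> logn p (Q + i) = logn p i.
Proof.
move=> i0 iq; apply: logn_eq; rewrite ?addn_gt0 ?i0 ?orbT // => e.
have ltQ : (Q + i < p ^ j.+1)%N.
  rewrite expnS; apply: leq_trans (_ : c.+1 * q <= _)%N; last by rewrite leq_mul2r ltcp orbT.
  by rewrite mulSn addnC ltn_add2r.
have [le_ej | lt_je] := leqP e j; last by rewrite !ndvd ?addn_gt0 ?i0 ?orbT //; lia.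
by rewrite dvdn_addr // dvdn_mull // dvdn_exp2l.
Qed.

Let logn0_ndvd a : (0 < a)%N -> logn p a = 0%N -> ~~ (p %| a)%N.
Proof. by move=> a0 la; have := pfactor_dvdn 1 pr_p a0; rewrite expn1 la => ->. Qed.

(** Consecutive values have ratio (Q - k - 1) / (k + 1), of p-adic valuation 0 by [logn_subQ]. *)
Lemma p'binomial_pred k : (k < Q)%N -> ~~ (p %| 'C(Q.-1, k))%N.
Proof.
move=> ltkQ; apply: logn0_ndvd; first by rewrite bin_gt0; lia.
elim: k ltkQ => [|k IHk] ltkQ; first by rewrite bin0 logn1.
have := congr1 (logn p) (mul_bin_left Q.-1 k).
have -> : (Q.-1 - k = Q - k.+1)%N by lia.
rewrite !lognM ?bin_gt0 ?subn_gt0 //; try lia.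
by rewrite logn_subQ // IHk; lia.
Qed.

(** Likewise with the ratio (Q + s + 1) / (s + 1) and [logn_addQ]. *)
Lemma p'binomial_add s : (s < q)%N -> ~~ (p %| 'C(Q + s, Q))%N.
Proof.
move=> ltsq; apply: logn0_ndvd; first by rewrite bin_gt0 leq_addr.
elim: s ltsq => [|s IHs] ltsq; first by rewrite addn0 binn logn1.
have := congr1 (logn p) (mul_bin_down (Q + s.+1) Q).
have -> : (Q + s.+1 - Q = s.+1)%N by lia.
rewrite addnS /= -addnS !lognM ?bin_gt0 ?leq_addr ?addn_gt0 ?orbT //.
by rewrite logn_addQ // IHs; lia.
Qed.

End BinomialsModP.

Section RedPPart.

Variables (p : nat) (F : fieldType) (red : algC -> F).
Hypothesis redP : modular_reduction p red.

(** On the cyclic group generated by x, irreducible characters are linear. Their values at the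
    p-part are roots of unity of p-power order, which reduce to 1 in characteristic p. *)
Lemma red_vchar_p'part (gT : finGroupType) (G : {group gT}) (phi : 'CF(G)) x :
  phi \in 'Z[irr G] -> x \in G -> red (phi x) = red (phi x.`_(p^')%g).
Proof.
have [pF red1 redD redM _] := redP.
move=> Zphi Gx; pose H := <[x]>%G.
have sHG : H \subset G by rewrite cycle_subG.
have Hx : x \in H := cycle_id x.
have Zres : 'Res[H] phi \in 'Z[irr H] by rewrite cfRes_vchar.
have phiE y : y \in H -> phi y = \sum_i '['Res[H] phi, 'chi_i] * 'chi[H]_i y.
  move=> Hy; rewrite -(cfResE _ sHG Hy) {1}['Res _]cfun_sum_cfdot sum_cfunE.
  by apply: eq_bigr => i _; rewrite cfunE.
have Ai i : '['Res[H] phi, 'chi_i] \in Aint by rewrite Aint_Cint ?Cint_cfdot_vchar_irr.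
have red_phi y : y \in H ->
    red (phi y) = \sum_i red '['Res[H] phi, 'chi_i] * red ('chi[H]_i y).
  move=> Hy; rewrite phiE // (red_sum redP) => [|i _].
    by apply: eq_bigr => i _; rewrite redM ?Aint_irr.
  exact: rpredM (Ai i) (Aint_irr _ _).
have [Hxp Hxp'] : x.`_p \in H /\ x.`_p^' \in H by rewrite !groupX.
rewrite !red_phi //; apply: eq_bigr => i _; congr (_ * _).
have lin_i : 'chi_i \is a linear_char by apply/char_abelianP/cycle_abelian.
rewrite -{1}(consttC p x) lin_charM // redM ?Aint_irr //.
suff -> : red ('chi_i x.`_p) = 1 by rewrite mul1r.
have p_ord : [pchar F].-nat #[x.`_p] by apply: sub_in_pnat (p_elt_constt p x) => r _ /eqP->.
have : ('chi_i x.`_p) ^+ #[x.`_p] = 1 by rewrite -lin_charX // expg_order lin_char1.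
move/(congr1 red); rewrite (redX redP) ?Aint_irr // red1 => a1.
have : (red ('chi_i x.`_p) - 1) ^+ #[x.`_p] = 0.
  by rewrite exprDn_pchar // a1 exprNn_pchar // expr1n subrr.
by move/eqP; rewrite expf_eq0 subr_eq0 => /andP[_ /eqP].
Qed.

End RedPPart.

(** * Disjoint q-cycles on consecutive blocks *)

Section BlockRotation.

Local Open Scope nat_scope.
Variables (n q c : nat).
Hypotheses (q_gt0 : 0 < q) (leQn : c * q <= n).

(** Rotates by one step each block {aq, ..., aq+q-1} with a < c and D a. *)
Definition rot (D : pred nat) (x : nat) :=
  if (x %/ q < c) && D (x %/ q) then x %/ q * q + (x %% q).+1 %% q else x.

Fact rot_subproof D (x : 'I_n) : rot D x < n.
Proof.
rewrite /rot; case: ifP => // /andP[ltxc _]; apply: leq_trans leQn.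
apply: leq_trans (_ : (x %/ q).+1 * q <= _); last by rewrite leq_mul2r ltxc orbT.
by rewrite mulSn addnC ltn_add2r ltn_mod.
Qed.

Let rot_div D (x : nat) : rot D x %/ q = x %/ q.
Proof.
rewrite /rot; case: ifP => // _; have lt_r : (x %% q).+1 %% q < q by rewrite ltn_mod.
by rewrite divnMDl // (divn_small lt_r) addn0.
Qed.

Fact rot_inj D : injective (fun x : 'I_n => Ordinal (rot_subproof D x)).
Proof.
move=> x y /(congr1 (@nat_of_ord n)) /= eq_rot; apply: val_inj => /=.
have eq_div : x %/ q = y %/ q by rewrite -(rot_div D x) eq_rot rot_div.
move: eq_rot; rewrite /rot -eq_div; case: ifP => // _ /addnI eq_mod.
rewrite (divn_eq x q) (divn_eq y q) eq_div; congr (_ + _).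
have : (x %% q + 1 == y %% q + 1 %[mod q]) by rewrite !addn1 eq_mod.
by rewrite eqn_modDr !modn_mod => /eqP.
Qed.

Definition block_rot D : 'S_n := perm (@rot_inj D).

Lemma block_rotX D (x : 'I_n) i : (block_rot D ^+ i)%g x =
  (if (x %/ q < c) && D (x %/ q) then x %/ q * q + (x %% q + i) %% q else x) :> nat.
Proof.
elim: i => [|i IHi].
  by rewrite perm1 addn0 modn_mod -divn_eq if_same.
rewrite expgSr permM permE /= /rot.
have divE : ((block_rot D ^+ i)%g x) %/ q = x %/ q.
  rewrite IHi; case: ifP => // _; have lt_r : (x %% q + i) %% q < q by rewrite ltn_mod.
  by rewrite divnMDl // (divn_small lt_r) addn0.
rewrite divE; case: ifP IHi => // _ ->; congr (_ + _).
by rewrite modnMDl modn_mod -addn1 modnDml addn1 addnS.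
Qed.

Lemma block_rotX_div D (x : 'I_n) i : (block_rot D ^+ i)%g x %/ q = x %/ q.
Proof.
rewrite block_rotX; case: ifP => // _.
have lt_r : (x %% q + i) %% q < q by rewrite ltn_mod.
by rewrite divnMDl // (divn_small lt_r) addn0.
Qed.

Lemma block_rotXq D : (block_rot D ^+ q = 1)%g.
Proof.
apply/permP=> x; apply: val_inj; rewrite /= block_rotX perm1.
by case: ifP => // _; rewrite modnDr modn_mod -divn_eq.
Qed.

Lemma block_rot_fix D (x : 'I_n) : ~~ ((x %/ q < c) && D (x %/ q)) -> block_rot D x = x.
Proof.
by move=> /negbTE xD; apply: val_inj; rewrite -[block_rot D]expg1 /= block_rotX xD.
Qed.

Lemma block_rot_moves D (x : 'I_n) : 1 < q -> (x %/ q < c) && D (x %/ q) -> block_rot D x != x.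
Proof.
move=> q_gt1 xD; apply/eqP=> /(congr1 (@nat_of_ord n)).
rewrite -[block_rot D]expg1 block_rotX xD {3}(divn_eq x q) => /addnI.
move/eqP; rewrite -{2}[x %% q]addn0 -[(_ + 0)](modn_small (_ : _ < q)) ?addn0 ?ltn_mod //.
by rewrite -{2}[x %% q]addn0 eqn_modDl mod0n modn_small.
Qed.

Lemma block_rot_trans D (x y : 'I_n) : (x %/ q < c) && D (x %/ q) -> y %/ q = x %/ q ->
  exists i, y = (block_rot D ^+ i)%g x.
Proof.
move=> xD eq_div; exists (y %% q + (q - x %% q)); apply: val_inj; rewrite /= block_rotX xD.
have lt_xq : x %% q < q by rewrite ltn_mod.
have -> : x %% q + (y %% q + (q - x %% q)) = y %% q + q by lia.
by rewrite modnDr modn_mod {1}(divn_eq y q) eq_div.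
Qed.

Lemma block_rot_commute D D' : commute (block_rot D) (block_rot D').
Proof.
apply/permP=> x; apply: val_inj; rewrite !permM !permE /=.
pose r y := y %/ q * q + (y %% q).+1 %% q.
have rotE D0 y : rot D0 y = if (y %/ q < c) && D0 (y %/ q) then r y else y by [].
rewrite rotE rot_div [RHS]rotE rot_div !rotE.
by case: (x %/ q < c) => //=; case: (D _) => //=; case: (D' _).
Qed.

Lemma lt_div_block (x : nat) : (x %/ q < c) = (x < c * q).
Proof. exact: ltn_divLR. Qed.

(* A permutation commuting with a cycle acts on its support as a power of it. *)
Lemma p'elt_fixes_blocks (u : 'S_n) : 1 < q -> coprime q #[u]%g ->
    (forall a, a < c -> commute u (block_rot (pred1 a))) ->
  forall x : 'I_n, x < c * q -> u x = x.
Proof.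
move=> q_gt1 co_qu cu x lt_xQ; have lt_a : x %/ q < c by rewrite lt_div_block.
pose r := block_rot (pred1 (x %/ q)); have cur : commute u r := cu _ lt_a.
have xD : (x %/ q < c) && pred1 (x %/ q) (x %/ q) by rewrite lt_a /= eqxx.
(* In another block u x would be fixed by r, and so would x, by commutation. *)
have eq_div : u x %/ q = x %/ q.
  apply/eqP; apply: contraTT (block_rot_moves q_gt1 xD) => ne_div; rewrite negbK.
  apply/eqP/(perm_inj (s := u)); rewrite -[LHS]permM -cur permM.
  by rewrite /r block_rot_fix //= (negPf ne_div) andbF.
have [i Dux] := block_rot_trans xD eq_div; rewrite -/r in Dux.
(* Taking for m the order of u, which is prime to q, gives q | i, that is u x = x. *)
have uX m : (u ^+ m)%g x = (r ^+ (i * m))%g x.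
  elim: m => [|m IHm]; first by rewrite muln0.
  rewrite expgSr permM IHm -permM -(commuteX (i * m) cur) permM Dux.
  by rewrite -permM -expgD mulnS.
have := uX #[u]%g; rewrite expg_order perm1 => /(congr1 (@nat_of_ord n)).
rewrite block_rotX xD {1}(divn_eq x q) => /addnI /eqP.
rewrite -{1}[x %% q]modn_mod -{1}[x %% q]addn0 eqn_modDl mod0n eq_sym -/(dvdn _ _).
rewrite Gauss_dvdl // => /dvdnP[t Di].
by rewrite Dux Di mulnC expgM block_rotXq expg1n perm1.
Qed.

End BlockRotation.

Lemma odd_permX (T : finType) (y : {perm T}) m : odd_perm (y ^+ m)%g = odd m && odd_perm y.
Proof.
elim: m => [|m IHm]; first by rewrite odd_perm1.
by rewrite expgSr odd_permM IHm /=; case: (odd m); case: (odd_perm y).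
Qed.

Lemma pgroup_gen_commuting p (gT : finGroupType) (A : {set gT}) :
    {in A &, forall x y, commute x y} -> {in A, forall x, p.-elt x} -> p.-group <<A>>.
Proof.
move=> cA pA; have cAA : abelian <<A>>.
  by rewrite abelian_gen; apply/centsP=> x Ax y Ay; apply: cA.
apply: pgroupS (pcore_pgroup p <<A>>); rewrite gen_subG; apply/subsetP=> x Ax.
have hallP := nilpotent_pcore_Hall p (abelian_nil cAA).
by rewrite (mem_normal_Hall hallP (pcore_normal _ _)) ?pA // mem_gen.
Qed.

(** * Congruence of the hook character on classes of p'-size *)

Section PrincipalBlockCongruence.

Variables (p : nat) (F : fieldType) (red : algC -> F).
Hypothesis redP : modular_reduction p red.
Variables (n j c s k : nat).
Local Notation q := (p ^ j)%N.
Local Notation Q := (c * q)%N.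
Hypotheses (p_gt2 : (2 < p)%N) (j_gt0 : (0 < j)%N) (Dn : n = (Q + s)%N).
Hypotheses (c_gt0 : (0 < c)%N) (ltsq : (s < q)%N) (ltkQ : (k < Q)%N).

Let pF : p \in [pchar F]. Proof. by case: redP. Qed.
Let pr_p : prime p. Proof. exact: pcharf_prime pF. Qed.
Let q_gt0 : (0 < q)%N. Proof. by rewrite expn_gt0 prime_gt0. Qed.
Let q_gt1 : (1 < q)%N. Proof. by rewrite -(expn0 p) ltn_exp2l ?prime_gt1. Qed.
Let leQn : (Q <= n)%N. Proof. by rewrite Dn leq_addr. Qed.
Let r D := block_rot q_gt0 leQn D.
Local Notation Theta := (hook_char n Q k).

Let p_r D : p.-elt (r D).
Proof.
apply: pnat_dvd (_ : #[r D]%g %| q)%N _; last by rewrite pnatX pnat_id.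
by rewrite order_dvdn block_rotXq.
Qed.

Let even_r D : r D \in 'Alt_('I_n).
Proof.
have := odd_permX (r D) q; rewrite block_rotXq odd_perm1 oddX orbC.
have -> : odd p by case: (even_prime pr_p) p_gt2 => [-> |].
by rewrite Alt_even /= => <-.
Qed.

Let g := r xpredT.

Let gX_low (x : 'I_n) i : ((g ^+ i)%g x < Q)%N = (x < Q)%N.
Proof. by rewrite -!(lt_div_block _ q_gt0) block_rotX_div. Qed.

Let g_low (x : 'I_n) : (g x < Q)%N = (x < Q)%N.
Proof. by rewrite -{1}[g]expg1 gX_low. Qed.

Let fix_low (u : 'S_n) (x : 'I_n) :
  (forall x : 'I_n, (x < Q)%N -> u x = x) -> (u x < Q)%N = (x < Q)%N.
Proof.
move=> fix_u; apply/idP/idP=> ltx; last by rewrite fix_u.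
by move: (ltx) => /fix_u /perm_inj <-.
Qed.

Let commute_g (u : 'S_n) : (forall x : 'I_n, (x < Q)%N -> u x = x) -> commute u g.
Proof.
move=> fix_u; apply/permP=> x; rewrite !permM.
have g_fix (z : 'I_n) : (z < Q)%N = false -> g z = z.
  by move=> gez; rewrite block_rot_fix // lt_div_block // gez.
have [ltx | gex] := boolP (x < Q)%N; first by rewrite !fix_u ?g_low.
by rewrite !g_fix ?fix_low // (negPf gex).
Qed.

(** On [low n Q] both u * g and g act as c disjoint q-cycles, so an invariant set of size n - Q = s
    < q must avoid it; [hook_char_eq] applies. *)
Let Theta_fix (u : 'S_n) : (forall x : 'I_n, (x < Q)%N -> u x = x) ->
  Theta (u * g)%g = Theta g.
Proof.
move=> fix_u; pose Z := low n Q.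
have Zu : u \in 'N(Z | 'P) by apply/stabP=> x; rewrite !inE fix_low.
have Zg : g \in 'N(Z | 'P) by apply/stabP=> x; rewrite !inE g_low.
have key (y : 'S_n) (B : {set 'I_n}) : {in Z, y =1 g} -> #|B| = (n - Q)%N ->
    y \in 'N(B | 'P) -> B = ~: Z.
  move=> yg cB nB; have disjBZ : [disjoint B & Z].
    apply/pred0P=> x /=; apply/negbTE/negP=> /andP[Bx]; rewrite inE => ltx.
    have ygX i : (y ^+ i)%g x = (g ^+ i)%g x.
      elim: i => [|i IHi]; first by rewrite !expg0.
      by rewrite !expgSr !permM IHi yg // inE gX_low.
    have inj_g : injective (fun i : 'I_q => (g ^+ i)%g x).
      move=> a b /(congr1 (@nat_of_ord n)); rewrite !block_rotX.
      rewrite andbT (lt_div_block _ q_gt0) ltx => /addnI/eqP.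
      by rewrite eqn_modDl !modn_small // => /eqP/val_inj.
    have: (#|codom (fun i : 'I_q => (g ^+ i)%g x)| <= #|B|)%N.
      apply/subset_leq_card/subsetP=> _ /codomP[i ->].
      by rewrite -ygX (stabP _ _ (groupX i nB)).
    rewrite card_codom // card_ord cB leqNgt Dn addKn => /negP[].
    exact: ltsq.
  apply/eqP; rewrite eqEcard -disjoints_subset disjBZ /=.
  by rewrite cardsCs setCK card_ord card_low // cB.
have ugZ : {in Z, (u * g)%g =1 g} by move=> x; rewrite inE permM => /fix_u->.
apply: (hook_char_eq leQn (Z := Z)) => //; first exact: groupM.
by move=> B cB /orP[] nB; apply: key cB nB.
Qed.

(** The centralizer of x contains a Sylow p-subgroup of A_n, so after conjugation the p'-part u of x
    commutes with the c disjoint q-cycles and fixes [low n Q] pointwise. As u is the p'-part of u *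
    g and g is a p-element, modulo ker red Theta(x) = Theta(u) = Theta(u g) = Theta(g) =
    Theta(1). *)
Lemma hook_char_principal (x : 'S_n) : x \in 'Alt_('I_n) ->
  ~~ (p %| #|x ^: 'Alt_('I_n)|)%N -> red (Theta x) = red (Theta 1%g).
Proof.
move=> Ax p'xA; pose A := 'Alt_('I_n)%G; pose C := 'C_A[x]%G.
have ZTheta := hook_char_vchar n Q k.
have redTheta y : red (Theta y) = red (Theta y.`_p^').
  by apply: (red_vchar_p'part redP) ZTheta _; rewrite inE.
pose rs := [set r (pred1 (a : nat)) | a : 'I_c].
have pE : p.-group <<rs>>.
  apply: pgroup_gen_commuting => [_ _ /imsetP[a _ ->] /imsetP[b _ ->] | _ /imsetP[a _ ->] //].
  exact: block_rot_commute.
have sEA : <<rs>> \subset A.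
  by rewrite gen_subG; apply/subsetP=> _ /imsetP[a _ ->].
have [P sylP] := Sylow_exists p C.
have sylPA : p.-Sylow(A) P.
  rewrite pHallE (subset_trans (pHall_sub sylP)) ?subsetIl //= (card_Hall sylP).
  rewrite -(LagrangeI A 'C[x]) -indexgI index_cent1 partnM ?cardG_gt0 //.
    by rewrite [(#|x ^: A|`_p)%N]part_p'nat ?muln1 // p'natE.
  by rewrite -index_cent1 indexg_gt0.
have [y Ay sEyP] := Sylow_Jsub sylPA sEA pE.
pose u := (x.`_p^' ^ y^-1)%g.
have cu a : (a < c)%N -> commute u (r (pred1 a)).
  move=> lt_ac; have Ea : r (pred1 a) \in <<rs>>.
    by rewrite mem_gen //; apply/imsetP; exists (Ordinal lt_ac).
  have : (r (pred1 a) ^ y)%g \in 'C[x].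
    have sPC : P \subset 'C[x] := subset_trans (pHall_sub sylP) (subsetIr _ _).
    by rewrite (subsetP sPC) // (subsetP sEyP) // memJ_conjg.
  move/cent1P => cxr; have : commute (r (pred1 a) ^ y)%g x.`_p^' by apply: commuteX.
  move=> cur; rewrite /commute -[r _](conjgK y) -!conjMg.
  by rewrite cur.
have p'u : p^'.-elt u by rewrite p_eltJ p_elt_constt.
have fix_u (z : 'I_n) : (z < Q)%N -> u z = z.
  apply: (p'elt_fixes_blocks q_gt1 _ cu).
  by rewrite coprimeXl // prime_coprime // -p'natE.
rewrite redTheta -(cfunJ Theta (x.`_p^')%g (_ : y^-1%g \in _)) ?inE // -/u.
have -> : u = (u * g).`_p^'.
  rewrite consttM; last exact: commute_g.
  rewrite (constt_p_elt p'u) [X in (_ * X)%g](constt1P _) ?mulg1 //.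
  by rewrite p_eltNK; apply: p_r.
rewrite -redTheta Theta_fix // redTheta [X in Theta X](constt1P _) //.
by rewrite p_eltNK; apply: p_r.
Qed.

End PrincipalBlockCongruence.

(** * Assembling the virtual character for the alternating group *)

Section Criterion.

Variables (p : nat) (F : fieldType) (red : algC -> F).
Hypothesis redP : modular_reduction p red.

(** Collects what is required of theta in a form stable under isomorphism; the last clause says that
    no constituent has L-fixed vectors. *)
Definition avoiding_vchar (gT : finGroupType) (G : {group gT}) (theta : 'CF(G)) (L : {group gT}) :=
  [/\ theta \in 'Z[irr G], ~~ (p %| theta 1%g)%C,
      {in G, forall x, ~~ (p %| #|x ^: G|)%N -> red (theta x) = red (theta 1%g)},
      (L \subset G) && p^'.-group L
    & forall i, '[theta, 'chi_i] != 0 -> \sum_(x in L) 'chi_i x = 0].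

Lemma avoiding_vcharP (gT : finGroupType) (G : {group gT}) theta L :
    @avoiding_vchar gT G theta L ->
  exists2 i : Iirr G, i \in p'_principal_block p red G
    & decomposition_number p red 'chi_i (trivial_brauer p G) 0.
Proof.
case=> Ztheta p'theta1 thetaB /andP[sLG p'L] killL.
have [i iB nz_i] := p'_principal_block_constituent redP Ztheta p'theta1 thetaB.
by exists i => //; apply: (decomposition_number_trivial0 redP sLG p'L); apply: killL.
Qed.

Lemma avoiding_vchar_isom (gT hT : finGroupType) (G : {group gT}) (H : {group hT})
    (f : {morphism G >-> hT}) (isoGH : isom G H f) theta L :
  @avoiding_vchar gT G theta L -> avoiding_vchar (cfIsom isoGH theta) (f @* L).
Proof.
case=> Ztheta p'theta1 thetaB /andP[sLG p'L] killL.
have [injf Df] := isomP isoGH.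
split.
- rewrite [theta]cfun_sum_cfdot linear_sum rpred_sum // => i _ /=.
  rewrite linearZ /= -isom_IirrE; apply: rpredZ_int; rewrite ?irr_vchar //.
  exact: Cint_cfdot_vchar_irr.
- by rewrite cfIsom1.
- move=> y; rewrite -{1}Df => /morphimP[x _ Gx ->] p'x.
  rewrite cfIsomE // cfIsom1; apply: thetaB => //; apply: contra p'x.
  have -> : #|f x ^: H| = #|x ^: G| by rewrite -Df -morphim_class // card_injm ?class_subG.
  by [].
- by rewrite -{1}Df morphimS // morphim_pgroup.
move=> i; rewrite -(isom_IirrKV isoGH i) isom_IirrE cfIsom_iso => /killL sum0.
rewrite -[RHS]sum0 {sum0}; move: (isom_Iirr _ i) => j.
rewrite /= morphimEsub // big_imset /=; last first.
  by move=> x y Lx Ly; apply: (injmP injf); apply: (subsetP sLG).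
by apply: eq_bigr => x Lx; rewrite cfIsomE ?(subsetP sLG).
Qed.

Lemma Alt_avoiding_vchar n : (3 < p)%N -> (p <= n)%N ->
  exists theta : 'CF('Alt_('I_n)), exists L, avoiding_vchar theta L.
Proof.
move=> p_gt3 le_pn; have [pF _ _ _ _] := redP; have pr_p := pcharf_prime pF.
have p_gt1 := prime_gt1 pr_p.
pose j := trunc_log p n; pose q := (p ^ j)%N; pose c := (n %/ q)%N; pose s := (n %% q)%N.
(* k is the number of blocks of [four_blocks n], so any k + 1 points include two in one block. *)
pose Q := (c * q)%N; pose k := ((n + 3) %/ 4)%N.
have q_gt0 : (0 < q)%N by rewrite expn_gt0 prime_gt0.
have /andP[leqn ltnpq] : (q <= n < p ^ j.+1)%N by apply: trunc_log_bounds p_gt1 _; lia.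
have j_gt0 : (0 < j)%N by rewrite trunc_log_gt0 p_gt1; lia.
have Dn : n = (Q + s)%N by apply: divn_eq.
have ltsq : (s < q)%N by rewrite ltn_mod.
have c_gt0 : (0 < c)%N by rewrite divn_gt0.
have ltcp : (c < p)%N by rewrite ltn_divLR // -expnS.
have dvd_pQ : (p %| Q)%N by rewrite dvdn_mull // dvdn_exp.
have leqQ : (q <= Q)%N by rewrite leq_pmull.
have leQn : (Q <= n)%N by rewrite Dn leq_addr.
have p_ge5 : (4 < p)%N by case: (p) pr_p p_gt3 => [|[|[|[|[|]]]]].
have Q_ge5 : (4 < Q)%N by apply: leq_trans p_ge5 (dvdn_leq _ dvd_pQ); lia.
have Q_ne6 : Q != 6%N.
  apply: contraL dvd_pQ => /eqP->; rewrite (Euclid_dvdM 2 3) // negb_or.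
  by rewrite !gtnNdvd // ltnW.
(* Failure means s <= k and Q <= 2k, so n <= 3k and n <= 9; with Q >= 5 this leaves only Q = 6, n =
   9. *)
have sk_or_Qk : (k < s)%N || (2 * k + 1 <= Q)%N by apply/orP; rewrite /k; lia.
have ltkQ : (k < Q)%N by rewrite /k; lia.
have swap_in (X : {set 'I_n}) : (k < #|X|)%N -> exists u v,
    [/\ u \in X, v \in X, u != v & tperm u v \in four_blocks_group n].
  exact: four_blocks_swap.
have swap_out (X B : {set 'I_n}) : (#|X| <= k)%N -> #|B| = (n - Q)%N ->
    [disjoint X & B] -> exists u v, [/\ u \notin X, v \notin X,
      (u \in B) = (v \in B), u != v & tperm u v \in four_blocks_group n].
  move=> cX cB dXB; have {}cB : #|B| = s by rewrite cB Dn addKn.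
  (* Two points of one block are found inside B if s > k, and otherwise outside both X and B, where
     at least Q - k > k points remain. *)
  case/orP: sk_or_Qk => [lt_ks | le_kQ].
    have [|u [v [Bu Bv uv Kuv]]] := @four_blocks_swap n B; first by rewrite cB.
    by exists u, v; rewrite Bu Bv !(disjointFl dXB).
  have [|u [v [Cu Cv uv Kuv]]] := @four_blocks_swap n (~: (X :|: B)).
    rewrite cardsCs setCK card_ord cardsU (eqP (_ : X :&: B == set0)) ?setI_eq0 //.
    rewrite cards0 cB -/k; lia.
  move: Cu Cv; rewrite !inE !negb_or => /andP[X'u B'u] /andP[X'v B'v].
  by exists u, v; split; rewrite ?(negPf B'u) ?(negPf B'v).
pose A := 'Alt_('I_n)%G; pose L := (four_blocks_group n :&: A)%G.
have p'Theta1 : ~~ (p %| hook_char n Q k 1%g)%C.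
  rewrite hook_char1 //; last by lia.
  rewrite rpredMsign dvdC_nat Euclid_dvdM // negb_or.
  by rewrite p'binomial_pred //= Dn p'binomial_add.
exists ('Res[A] (hook_char n Q k)), L; split.
- by rewrite cfRes_vchar ?hook_char_vchar.
- by rewrite cfRes1.
- move=> x Ax p'x; rewrite cfRes1 cfResE ?subsetT //.
  by apply: (hook_char_principal redP (s := s)) => //; lia.
- rewrite subsetIr; apply: pgroupS (subsetIl _ _) _.
  exact: p'group_four_blocks.
by move=> i; apply: hook_Alt_constituent_sum.
Qed.

End Criterion.

Theorem proposition2p2 (n : nat) (n_ge5 : (5 <= n)%N) :
  property_star ('Alt_('I_n))%G.
Proof.
move=> p pr_p p_gt3 p_dvA gT H _ isoN pHN F red redP.
have n2 : (1 < n)%N by apply: leq_trans n_ge5.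
have p_le_n : (p <= n)%N.
  apply: (prime_dvdn_fact pr_p); rewrite -{1}(card_ord n) -card_Alt ?card_ord //.
  by rewrite dvdn_mull.
have nab := Alt_nonabelian pr_p p_gt3 p_dvA.
rewrite card_ord in nab; have {}nab := nab n_ge5.
pose N := [group of gsocle H].
have {}isoN : N \isog 'Alt_('I_n) by [].
have simA : simple 'Alt_('I_n) by rewrite simple_Alt5 ?card_ord.
have cN1 : 'C_H(N) = 1%g.
  apply/cent_gsocle/center_simple; first by rewrite (isog_simple isoN).
  by rewrite (isog_abelian isoN).
have [f injf fN] := isogP isoN.
have HN : H :=: N.
  apply: (Alt_odd_extension (gsocle_normal H) injf fN cN1 _ pr_p p_gt3) => //.
    by rewrite card_ord.
  by rewrite card_ord.
have /isog_symr := isoN; rewrite -HN => /isog_isom[g isog_g].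
have [theta [L aL]] := Alt_avoiding_vchar redP p_gt3 p_le_n.
exact: (avoiding_vcharP redP (avoiding_vchar_isom isog_g aL)).
Qed.
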